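(* Let $K$ be a field, $S=K[x_1,\dots,x_n]$, and let $I\subset S$ be a monomial ideal of minimal intersection type. Then: (a) $u^k\in\mathcal{G}(I^{(k)})$ for every $u\in\mathcal{G}(I)$ and all $k\ge1$. (b) $\mathrm{reg}\,I^{(k)}\ge\omega(I^{(k)})\ge\omega(I)k$ for all $k\ge1$. (c) If $I$ has linear powers, then $\mathrm{reg}\,I^{(k)}\ge\mathrm{reg}\,I^{k}$ for all $k\ge1$. (d) If $I$ has linear powers, $\mathrm{reg}_x\,\mathcal{R}_s(I)=0$ and $d(I,k)=\omega(I)k$ for all $k\ge1$, then $\mathrm{reg}\,I^{(k)}=\mathrm{reg}\,I^{k}$ for all $k\ge1$.
   Context: $S$ is standard graded; $\mathrm{reg}$ is Castelnuovo–Mumford regularity; $\mathcal{G}(L)$ is the minimal monomial generating set of a monomial ideal $L$; $\omega(L)$ is the largest degree of a minimal homogeneous generator of a graded ideal $L$. The $k$th symbolic power is $I^{(k)}=\bigcap_{P\in\mathrm{Ass}(I)}(I^kS_P\cap S)$, with $\mathrm{Ass}(I)=\mathrm{Ass}(S/I)$. A monomial ideal is of *intersection type* if it is an intersection of powers of monomial prime ideals, and of *minimal intersection type* if moreover it has no embedded associated primes; equivalently $I=\bigcap_{i=1}^mP_i^{k_i}$ with $m\ge1$, $k_i\ge1$, the $P_i$ monomial primes (generated by non-empty sets of variables) with $P_i\not\subseteq P_j$ for $i\ne j$. $I$ *has linear powers* if $I^k$ has a linear resolution for all $k\ge1$. $\mathcal{R}_s(I)=\bigoplus_{k\ge0}I^{(k)}t^k\subset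 S[t]$ is the symbolic Rees algebra, a finitely generated $K$-algebra with minimal monomial generators $x_1,\dots,x_n,u_1t^{q_1},\dots,u_rt^{q_r}$, where $u_j\in S$ are monomials and $q_j>0$. Set $d(I,k)=\max\{\sum_sc_s\deg(u_s): c\in\mathbb{Z}_{\ge0}^r,\ \sum_sc_sq_s\le k\}$. Let $T=K[x_1,\dots,x_n,y_1,\dots,y_r]$ be bigraded by $\mathrm{bideg}(x_i)=(1,0)$, $\mathrm{bideg}(y_j)=(\deg u_j,q_j)$, acting on $\mathcal{R}_s(I)$ through $x_i\mapsto x_i$, $y_j\mapsto u_jt^{q_j}$. If $F_i=\bigoplus_jT(-a_{ij},-b_{ij})$ are the modules in the minimal bigraded free $T$-resolution of $\mathcal{R}_s(I)$, then $\mathrm{reg}_x\,\mathcal{R}_s(I)=\max_{i,j}\{a_{ij}-i\}$. *)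

(* Defs.v *)
From mathcomp Require Import all_boot all_order all_algebra.
From mathcomp Require Import mpoly.
From Stdlib Require Import ClassicalEpsilon.

Set Implicit Arguments.
Unset Strict Implicit.
Unset Printing Implicit Defensive.

Import Order.TTheory GRing.Theory Num.Theory.
Local Open Scope ring_scope.

(* Ideals are Prop-valued membership predicates and are compared              *)
(* extensionally.                                                             *)
Section Ideals.
Variable R : comNzRingType.
Implicit Types (I J P X Y : R -> Prop) (f g : R).

Definition is_ideal I : Prop :=
  [/\ I 0, (forall f g, I f -> I g -> I (f + g))
    & forall f g, I g -> I (f * g)].

Definition prime_ideal P : Prop :=
  [/\ is_ideal P, ~ P 1 & forall f g, P (f * g) -> P f \/ P g].

Definition ideal_gen X f : Prop :=
  exists s : seq (R * R),
    (forall p, p \in s -> X p.2) /\ f = \sum_(p <- s) p.1 * p.2.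

Definition ideal_pow I (k : nat) : R -> Prop :=
  ideal_gen (fun f => exists g : 'I_k -> R,
                        (forall i, I (g i)) /\ f = \prod_i g i).

Definition generates X I : Prop := forall f, I f <-> ideal_gen X f.

Definition minimally_generates X I : Prop :=
  generates X I /\
  forall Y, (forall f, Y f -> X f) -> generates Y I -> forall f, X f -> Y f.

(* P \in Ass(R/I): P is prime and is the annihilator (I : f) of a class f + I. *)
Definition associated_prime I P : Prop :=
  prime_ideal P /\ exists f, forall g, P g <-> I (g * f).

(* I^k R_P \cap R consists of the f with f/1 = h/s for some h \in I^k, s \notin P; *)
(* for R a domain this means s * f \in I^k for some s \notin P.               *)
Definition symbolic_power I (k : nat) f : Prop :=
  forall P, associated_prime I P -> exists2 s, ~ P s & ideal_pow I k (s * f).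

(* The K-subalgebra generated by X, where K acts on R through iota.           *)
Inductive subalgebra_gen (K : Type) (iota : K -> R) X : R -> Prop :=
| SubalgScalar c : subalgebra_gen iota X (iota c)
| SubalgGen f : X f -> subalgebra_gen iota X f
| SubalgAdd f g : subalgebra_gen iota X f -> subalgebra_gen iota X g ->
    subalgebra_gen iota X (f + g)
| SubalgMul f g : subalgebra_gen iota X f -> subalgebra_gen iota X g ->
    subalgebra_gen iota X (f * g).

End Ideals.

Section MonomialIdeals.
Variables (K : fieldType) (n : nat).
Local Notation S := {mpoly K[n]}.
Implicit Types I L : S -> Prop.

Definition monomial_prime (V : {set 'I_n}) : S -> Prop :=
  ideal_gen (fun f => exists2 i, i \in V & f = 'X_i).

Definition minimal_intersection_type I : Prop :=
  exists (m : nat) (V : 'I_m -> {set 'I_n}) (e : 'I_m -> nat),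
    [/\ (0 < m)%N,
        forall i, V i != set0 /\ (0 < e i)%N,
        forall i j, i != j ->
          ~ (forall f, monomial_prime (V i) f -> monomial_prime (V j) f)
      & forall f, I f <-> forall i, ideal_pow (monomial_prime (V i)) (e i) f].

(* Monomials are represented by their exponent vectors.                       *)
Definition minimal_monomial_generator L (u : 'X_{1..n}) : Prop :=
  exists X : S -> Prop,
    [/\ forall f, X f -> exists v : 'X_{1..n}, f = 'X_[v],
        minimally_generates X L & X 'X_[u]].

Definition minimal_generator_degree L (d : nat) : Prop :=
  exists X : S -> Prop,
    [/\ forall f, X f -> exists e, f \is e.-homog,
        minimally_generates X L & exists2 f, X f & f \is d.-homog].

Definition omega L : nat :=
  epsilon (inhabits 0%N) (fun d => minimal_generator_degree L d /\
    forall d', minimal_generator_degree L d' -> (d' <= d)%N).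

End MonomialIdeals.

(* F_i = \bigoplus_j A(- shift i j) over A = K[x_1, ..., x_m], elements being *)
(* row vectors; the map F_(i+1) -> F_i is right multiplication by diff i, and *)
(* F_0 -> M, for M contained in B, sends the j-th basis element to aug j.     *)
(* The modules resolved below live in nonnegative degrees, so that shifts in  *)
(* nat, or in nat * nat, suffice.                                             *)
Record free_complex (K : fieldType) (m : nat) (G B : Type) := FreeComplex {
  rank : nat -> nat;
  shift : forall i, 'I_(rank i) -> G;
  aug : 'I_(rank 0) -> B;
  diff : forall i, 'M[{mpoly K[m]}]_(rank i.+1, rank i) }.

Arguments rank {K m G B} _ _.
Arguments shift {K m G B} _ _ _.
Arguments aug {K m G B} _ _.
Arguments diff {K m G B} _ _.

(* Minimal graded free resolutions over A = K[x_1, ..., x_m], graded by G with *)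
(* deg x_i = w i.  The resolved module M is an additive subgroup of a ring B  *)
(* on which A acts through phi, and component d consists of the elements of B *)
(* of degree d.  This covers both an ideal of A (phi = id) and the symbolic   *)
(* Rees algebra as a module over a polynomial ring mapping onto it.           *)
Section Resolutions.
Variables (K : fieldType) (m : nat) (G : nmodType) (w : 'I_m -> G).
Local Notation A := {mpoly K[m]}.
Variables (B : comNzRingType) (phi : A -> B) (component : G -> B -> Prop).
Variable M : B -> Prop.

Definition weighted_degree (a : 'X_{1..m}) : G := \sum_i w i *+ a i.

Definition augmentation (F : free_complex K m G B) (v : 'rV[A]_(rank F 0)) : B :=
  \sum_j phi (v 0 j) * aug F j.

Arguments augmentation : clear implicits.

Record minimal_free_resolution (F : free_complex K m G B) : Prop := {
  aug_homogeneous : forall j, component (shift F 0 j) (aug F j);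
  diff_homogeneous : forall i j l a, a \in msupp (diff F i j l) ->
    weighted_degree a + shift F i l = shift F i.+1 j;
  aug_image : forall b, M b <-> exists v, b = augmentation F v;
  exact_at_0 : forall v : 'rV_(rank F 0),
    augmentation F v = 0 <-> exists u, v = u *m diff F 0;
  exact_at_S : forall i (v : 'rV_(rank F i.+1)),
    v *m diff F i = 0 <-> exists u, v = u *m diff F i.+1;
  (* diff F i maps F_(i+1) into (x_1, ..., x_m) F_i *)
  diff_minimal : forall i j l, (diff F i j l)@_0%MM = 0 }.

(* The maximum of deg(shift i j) - i; here deg is the identity for reg and    *)
(* the first projection of nat * nat for reg_x.                               *)
Definition is_regularity (deg : G -> nat) (r : int) : Prop :=
  exists F : free_complex K m G B,
    [/\ minimal_free_resolution F,
        exists i (j : 'I_(rank F i)), (deg (shift F i j))%:Z - i%:Z = r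
      & forall i (j : 'I_(rank F i)), (deg (shift F i j))%:Z - i%:Z <= r].

Definition regularity (deg : G -> nat) : int :=
  epsilon (inhabits 0) (is_regularity deg).

End Resolutions.

Section StandardGraded.
Variables (K : fieldType) (n : nat).
Local Notation S := {mpoly K[n]}.
Implicit Types I L : S -> Prop.

Definition standard_resolution L (F : free_complex K n nat S) : Prop :=
  minimal_free_resolution (fun=> 1%N) id (fun d f => f \is d.-homog) L F.

Definition reg L : int :=
  regularity (fun=> 1%N) id (fun d (f : S) => f \is d.-homog) L id.

Definition linear_resolution L : Prop :=
  exists (F : free_complex K n nat S) (d : nat),
    standard_resolution L F /\
    forall i (j : 'I_(rank F i)), shift F i j = (d + i)%N.

Definition linear_powers I : Prop :=
  forall k, (0 < k)%N -> linear_resolution (ideal_pow I k).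

End StandardGraded.

(* The symbolic Rees algebra, inside S[t] = {poly S}.                         *)
Section SymbolicRees.
Variables (K : fieldType) (n : nat) (I : {mpoly K[n]} -> Prop).
Local Notation S := {mpoly K[n]}.

Definition symbolic_rees (f : {poly S}) : Prop :=
  forall k, symbolic_power I k f`_k.

Variables (r : nat) (u : 'I_r -> 'X_{1..n}) (q : 'I_r -> nat).

(* x_1, ..., x_n, u_1 t^(q_1), ..., u_r t^(q_r) *)
Definition rees_gen (i : 'I_(n + r)) : {poly S} :=
  match split i with
  | inl i => ('X_i)%:P
  | inr j => ('X_[u j])%:P * 'X^(q j)
  end.

Definition scalar_rees (c : K) : {poly S} := (c%:MP)%:P.

Definition generates_rees (A : {set 'I_(n + r)}) : Prop :=
  forall f, symbolic_rees f <->
    subalgebra_gen scalar_rees (fun g => exists2 i, i \in A & g = rees_gen i) f.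

Definition minimal_rees_generators : Prop :=
  [/\ forall j, (0 < q j)%N,
      generates_rees setT
    & forall A, generates_rees A -> A = setT].

(* As q j > 0, the condition \sum_s c_s q_s <= k forces c_s <= k, so the      *)
(* maximum ranges over finitely many c.                                       *)
Definition rees_d (k : nat) : nat :=
  \max_(c : {ffun 'I_r -> 'I_k.+1} | (\sum_s c s * q s <= k)%N)
     \sum_s (c s * mdeg (u s))%N.

Definition rees_bideg (i : 'I_(n + r)) : nat * nat :=
  match split i with
  | inl _ => (1%N, 0%N)
  | inr j => (mdeg (u j), q j)
  end.

Definition rees_map : {mpoly K[n + r]} -> {poly S} := mmap scalar_rees rees_gen.

Definition rees_bihomog (d : nat * nat) (f : {poly S}) : Prop :=
  exists2 g : S, g \is (d.1).-homog & f = g%:P * 'X^(d.2).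

Definition reg_x_rees : int :=
  regularity rees_bideg rees_map rees_bihomog symbolic_rees fst.

End SymbolicRees.

(* Main.v *)
(* If I is the intersection of the P_i^(e_i), the embedded-free hypothesis     *)
(* gives Ass(I) = {P_i} and I^(k) is the intersection of the P_i^(k e_i).     *)
(* A monomial u in I is a minimal generator iff each variable dividing u      *)
(* lies in some P_i for which u has P_i-degree exactly e_i; this condition is *)
(* inherited by u^k, whence (a) and omega(I^(k)) >= k omega(I).  Generator    *)
(* degrees occur as shifts in homological degree 0, so they bound reg.  If I  *)
(* has linear powers, u^k for u of degree omega(I) shows that I^k is generated *)
(* in degree k omega(I), so reg I^k = k omega(I); this gives (c).  For (d),   *)
(* the part of t-degree k of a bigraded T-resolution of R_s(I) is a graded    *)
(* S-free resolution of I^(k) with basis elements y^c e_j; reg_x = 0 and      *)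
(* d(I, k) = k omega(I) bound their degrees by i + k omega(I) in homological  *)
(* degree i, and the shifts of a minimal resolution are bounded by those of   *)
(* any other resolution.  Since reg and reg_x are chosen by epsilon, they     *)
(* carry information only once minimal resolutions of finite length are known *)
(* to exist: this needs Hilbert's basis and syzygy theorems.                  *)
From HB Require Import structures.
Require Import Defs.
From mathcomp Require Import all_boot all_order all_algebra.
From mathcomp Require Import mpoly zify ring.
From Stdlib Require Import ClassicalEpsilon.

Set Implicit Arguments.
Unset Strict Implicit.
Unset Printing Implicit Defensive.

Import Order.TTheory GRing.Theory Num.Theory.
Local Open Scope ring_scope.

(** * Dickson's lemma and Hilbert's basis theorem *)

(** Everything about $I$ reduces to exponent vectors. Membership in $P_V^e$ means that every
    monomial has $V$-degree at least $e$, and this order is a valuation ([order_ge_cancel]), so each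
    $P_i^{e_i}$ is primary. Since the $P_i$ are incomparable, some monomial outside $P_i$ lies in
    all the other components; multiplying by its powers carries $P_i^{ke_i}$ into $I^k$. Hence
    $I^{(k)}=\bigcap_i P_i^{ke_i}$ ([symbolic_powerP]), and minimal generators survive $k$th powers
    ([minimal_exponent_symbolic]).

    Lower bounds on regularity come from generators: a minimal generator is seen in homological
    degree 0 of every resolution ([resolution_minimal_exponent]). With linear powers this forces
    $\mathrm{reg}\,I^k=\omega(I)k$.

    Upper bounds come from comparing a minimal resolution with another complex of projectives
    ([shift_le]). It is applied to a second resolution of the same ideal ([resolution_shift_le]) and
    to the $t$-degree $k$ strand of a resolution of $\mathcal{R}_s(I)$ ([strand_shift_le]).

    For [reg] and [reg_x_rees] to denote actual regularities, finite minimal resolutions must exist: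
    Dickson's lemma gives Hilbert's basis theorem, iterated minimal covers give a resolution, and
    the syzygy theorem bounds its length ([regularityP]). *)

Lemma choice_fun (T U : Type) (R : T -> U -> Prop) :
  (forall x, exists y, R x y) -> exists f : T -> U, forall x, R x (f x).
Proof.
move=> h; exists (fun x => proj1_sig (constructive_indefinite_description _ (h x))).
by move=> x; case: constructive_indefinite_description.
Qed.

Lemma ex_min_nat (P : nat -> Prop) :
  (exists n, P n) -> exists2 n, P n & forall m, P m -> (n <= m)%N.
Proof.
case=> n; elim/ltn_ind: n => n IH Pn.
case: (excluded_middle_informative (exists2 m, (m < n)%N & P m)) => [[m /IH h /h]|hn] //.
exists n => // m Pm; rewrite leqNgt; apply/negP => lt; apply: hn; by exists m.
Qed.

(** Every tail of [f] attains its minimum. Choosing such an index again and again, each time beyond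
    the previous one, gives the subsequence. *)
Lemma nondecreasing_subseq (f : nat -> nat) :
  exists2 h : nat -> nat, {homo h : i j / (i < j)%N} &
    {homo f \o h : i j / (i <= j)%N}.
Proof.
have /choice_fun[g hg] : forall N, exists i, (N <= i)%N /\
    forall j, (N <= j)%N -> (f i <= f j)%N.
  move=> N.
  have [|_ [i Ni ->] h] := @ex_min_nat (fun v => exists2 i, (N <= i)%N & v = f i).
    by exists (f N), N.
  by exists i; split=> // j Nj; apply: h; exists j.
pose h k := iter k (fun i => g i.+1) (g 0%N).
have hS i : (h i < h i.+1)%N by have [] := hg (h i).+1.
have hh : {homo h : i j / (i < j)%N}.
  by apply: homo_ltn hS; exact: ltn_trans.
exists h => //; apply: homo_leq => //; first exact: leq_trans.
case=> [|i] /=; first by apply: (proj2 (hg 0%N)).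
by apply: (proj2 (hg (h i).+1)); apply: ltnW; apply: leq_ltn_trans (hS i.+1); apply: hS.
Qed.

(** Subsequences are extracted one coordinate at a time; passing to a further subsequence keeps the
    earlier coordinates nondecreasing. *)
Lemma nondecreasing_subseq_mnm n (f : nat -> 'X_{1..n}) :
  exists2 h : nat -> nat, {homo h : i j / (i < j)%N} &
    forall i j, (i <= j)%N -> (f (h i) <= f (h j))%MM.
Proof.
have : forall k, exists2 h : nat -> nat, {homo h : i j / (i < j)%N} &
    forall l : 'I_n, (l < k)%N -> forall i j, (i <= j)%N -> (f (h i) l <= f (h j) l)%N.
  elim=> [|k [h hh hl]]; first by exists id.
  case: (ltnP k n) => [kn|nk]; last first.
    by exists h => // l _; apply: hl; apply: leq_trans nk.
  have [g gg gl] := nondecreasing_subseq (fun i => f (h i) (Ordinal kn)).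
  exists (h \o g) => [i j /gg /hh //|l].
  rewrite ltnS leq_eqVlt => /orP[/eqP e|lk] i j ij /=.
    have -> : l = Ordinal kn by apply: val_inj.
    exact: gl.
  apply: hl => //; move: ij; rewrite leq_eqVlt => /orP[/eqP->//|/gg]; exact: ltnW.
move=> /(_ n)[h hh hl]; exists h => // i j ij; apply/mnm_lepP => l; exact: hl.
Qed.

(** Otherwise one could forever choose elements of [P] divisible by no earlier choice, against the
    existence of a nondecreasing subsequence. *)
Lemma dickson n (P : 'X_{1..n} -> Prop) :
  exists2 s : seq 'X_{1..n}, (forall a, a \in s -> P a) &
    forall a, P a -> exists2 b, b \in s & (b <= a)%MM.
Proof.
apply: NNPP => hn.
(* The premise on [s] stays inside the existential so that [g] is total; [lP] discharges it along
   the sequence. *)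
have /choice_fun[g hg] : forall s : seq 'X_{1..n}, exists a, (forall b, b \in s -> P b) ->
    P a /\ forall b, b \in s -> ~~ (b <= a)%MM.
  move=> s; apply: NNPP => hs; apply: hn; exists s.
    by move=> a sa; apply: NNPP => nP; apply: hs; exists a => /(_ _ sa).
  move=> a Pa; apply: NNPP => nb; apply: hs; exists a => _; split=> // b sb.
  by apply/negP => ba; apply: nb; exists b.
pose l k := iter k (fun s => g s :: s) [::].
have lP k : forall b, b \in l k -> P b.
  elim: k => // k IH b; rewrite inE => /orP[/eqP->|/IH //]; exact: (proj1 (hg _ IH)).
have mem i j : (i < j)%N -> g (l i) \in l j.
  elim: j => // j IH; rewrite ltnS leq_eqVlt inE => /orP[/eqP->|/IH->]; by rewrite ?eqxx ?orbT.
have [h hh hm] := nondecreasing_subseq_mnm (fun i => g (l i)).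
have /negP := proj2 (hg _ (lP (h 1%N))) _ (mem _ _ (hh 0%N 1%N isT)).
by apply; apply: hm.
Qed.

Section MFilter.
Variables (R : nzRingType) (n : nat).
Implicit Types (P : pred 'X_{1..n}) (p : {mpoly R[n]}).

Definition mfilter P p := \sum_(a <- msupp p | P a) p@_a *: 'X_[a].

Lemma mcoeff_mfilter P p a : (mfilter P p)@_a = if P a then p@_a else 0.
Proof.
rewrite /mfilter raddf_sum /=.
under eq_bigr => b _ do rewrite mcoeffZ mcoeffX.
rewrite -big_filter; have [sa|nsa] := boolP (a \in filter P (msupp p)).
  rewrite (bigD1_seq a) ?filter_uniq ?msupp_uniq //= eqxx mulr1 big1.
    by rewrite addr0; move: sa; rewrite mem_filter => /andP[->].
  by move=> b /negPf->; rewrite mulr0.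
rewrite big1_seq => [|b /andP[_ sb]].
  move: nsa; rewrite mem_filter; case: (P a) => //= /memN_msupp_eq0 ->//.
by case: eqP sb nsa => [->->//|_ _ _]; rewrite mulr0.
Qed.

Lemma msupp_mfilter P p a : a \in msupp (mfilter P p) -> P a /\ a \in msupp p.
Proof. by rewrite !mcoeff_msupp mcoeff_mfilter; case: (P a); rewrite ?eqxx. Qed.

Lemma mfilter_is_additive P : additive (mfilter P).
Proof.
move=> p q; apply/mpolyP => a.
by rewrite mcoeffB !mcoeff_mfilter mcoeffB; case: (P a); rewrite ?subr0.
Qed.

HB.instance Definition _ P :=
  GRing.isAdditive.Build {mpoly R[n]} {mpoly R[n]} (mfilter P) (mfilter_is_additive P).

Lemma mfilter_id P p : {in msupp p, forall a, P a} -> mfilter P p = p.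
Proof.
move=> h; apply/mpolyP => a; rewrite mcoeff_mfilter.
case: ifP => // nP; apply/esym/eqP; rewrite mcoeff_eq0; apply/negP => /h; by rewrite nP.
Qed.

Lemma mfilter_eq0 P p : {in msupp p, forall a, ~~ P a} -> mfilter P p = 0.
Proof.
move=> h; apply/mpolyP => a; rewrite mcoeff_mfilter mcoeff0.
case: ifP => // nP; apply/eqP; rewrite mcoeff_eq0; apply/negP => /h; by rewrite nP.
Qed.

End MFilter.

Lemma ideal_sum (R : comNzRingType) (L : R -> Prop) (hL : is_ideal L) (T : Type) (s : seq T)
  (P : pred T) (f : T -> R) : (forall i, P i -> L (f i)) -> L (\sum_(i <- s | P i) f i).
Proof.
by move=> h; apply: (big_ind L) => //; case: hL.
Qed.

(** * Hilbert's basis theorem for ideals and for submodules of free modules *)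

Section HilbertBasis.
Variables (K : fieldType) (m : nat).
Local Notation A := {mpoly K[m]}.

Lemma mlead_cancel (f g : A) : f != 0 -> g != 0 -> (mlead g <= mlead f)%MM ->
  exists c : A, f - c * g = 0 \/ (mlead (f - c * g) < mlead f)%O.
Proof.
move=> f0 g0 le; pose c : A := (mleadc f / mleadc g) *: 'X_[mlead f - mlead g].
have cf : mleadc f != 0 by rewrite mleadc_eq0.
have cg : mleadc g != 0 by rewrite mleadc_eq0.
have lc : mlead c = (mlead f - mlead g)%MM.
  by rewrite /c mleadZ_proper ?mleadXm // mcoeffX eqxx mulr1 mulf_neq0 ?invr_eq0.
have lcc : mleadc c = mleadc f / mleadc g.
  by rewrite lc /c mcoeffZ mcoeffX eqxx mulr1.
have lcg : mlead (c * g) = mlead f.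
  by rewrite mleadM_proper ?lcc ?divfK // lc submK.
have lccg : (c * g)@_(mlead f) = mleadc f.
  by rewrite -{1}(submK le) -lc mleadcM lcc divfK.
exists c; case: (eqVneq (f - c * g) 0) => [|nz]; [by left|right].
have : (mlead (f - c * g) <= mlead f)%O.
  by apply: le_trans (mleadB_le _ _) _; rewrite lcg joinxx.
rewrite le_eqVlt => /orP[/eqP e|//].
by move: nz; rewrite -mleadc_eq0 e mcoeffB lccg subrr eqxx.
Qed.

(** Dickson's lemma, applied to the leading exponents of [L], provides the generators. Division by
    them lowers the leading monomial, and the monomial order is well founded. *)
Lemma hilbert_basis_ideal (L : A -> Prop) : is_ideal L ->
  exists (p : nat) (g : 'I_p -> A), forall f, L f <-> exists c, f = \sum_i c i * g i.
Proof.
move=> hL; have [L0 LD LM] := hL.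
have [s sP sdom] := dickson (fun a => exists f, [/\ L f, f != 0 & mlead f = a]).
have /choice_fun[g hg] : forall i : 'I_(size s), exists f,
    [/\ L f, f != 0 & mlead f = tnth (in_tuple s) i].
  by move=> i; apply: sP; rewrite mem_tnth.
exists (size s), g => f; split; last first.
  by move=> [c ->]; apply: ideal_sum => // i _; apply: LM; case: (hg i).
have [l] : {l | l = mlead f} by exists (mlead f).
elim/(@ltmwf m): l f => l IH f lf Lf.
case: (eqVneq f 0) => [->|f0].
  by exists (fun=> 0); rewrite big1 // => i _; rewrite mul0r.
have [b sb ble] := sdom (mlead f) (ex_intro _ f (And3 Lf f0 erefl)).
have /tnthP[i bi] : b \in in_tuple s by [].
have [Lg g0 gl] := hg i.
have [|c hc] := mlead_cancel f0 g0; first by rewrite gl -bi.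
have Lc : L (f - c * g i) by rewrite -mulNr; apply: LD => //; apply: LM.
have [d hd] : exists d, f - c * g i = \sum_j d j * g j.
  case: hc => [e0|lt]; last by apply: IH Lc => //; rewrite lf.
  by exists (fun=> 0); rewrite e0 big1 // => j _; rewrite mul0r.
exists (fun j => d j + (i == j)%:R * c).
under eq_bigr => j _ do rewrite mulrDl.
rewrite big_split /= -hd (bigD1 i) //= big1 ?eqxx ?mul1r ?addr0 ?subrK //.
by move=> j /negPf; rewrite eq_sym => ->; rewrite !mul0r.
Qed.

Definition row_submodule r (N : 'rV[A]_r -> Prop) : Prop :=
  [/\ N 0, (forall u v, N u -> N v -> N (u + v)) & forall c v, N v -> N (c *: v)].

Lemma row_submodule_mulmx r p (N : 'rV[A]_r -> Prop) (D : 'M_(p, r)) :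
  row_submodule N -> (forall i, N (row i D)) -> forall u, N (u *m D).
Proof.
case=> N0 ND NZ h u; rewrite mulmx_sum_row.
by apply: (big_ind N) => // i _; apply: NZ.
Qed.

(** Induction on the rank: the first entries of [N] form a finitely generated ideal, and the rows of
    [N] with first entry 0 form a submodule of rank one less. Lifts of generators of the former,
    together with generators of the latter, generate [N]. *)
Lemma hilbert_basis r (N : 'rV[A]_r -> Prop) : row_submodule N ->
  exists (p : nat) (D : 'M_(p, r)), forall v, N v <-> exists u, v = u *m D.
Proof.
elim: r N => [|r IH]; [|rewrite -[r.+1]/(1 + r)%N]; move=> N hN; have [N0 ND NZ] := hN.
  exists 0%N, 0 => v; split=> [_|_]; last by rewrite thinmx0.
  by exists 0; rewrite !thinmx0.
pose L (a : A) := exists v : 'rV_r, N (row_mx (a%:M : 'M_1) v).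
have idL : is_ideal L.
  split=> [|a b [u hu] [v hv]|a b [v hv]].
  - by exists 0; rewrite raddf0 row_mx0.
  - by exists (u + v); rewrite raddfD /= -add_row_mx; apply: ND.
  - by exists (a *: v); rewrite -scale_scalar_mx -scale_row_mx; apply: NZ.
have [p [g hg]] := hilbert_basis_ideal idL.
have /choice_fun[w hw] : forall i, exists v : 'rV_r, N (row_mx ((g i)%:M : 'M_1) v).
  move=> i; apply/hg; exists (fun j => (i == j)%:R).
  rewrite (bigD1 i) //= eqxx mul1r big1 ?addr0 // => j /negPf.
  by rewrite eq_sym => ->; rewrite mul0r.
have [|q [D' hD']] := IH (fun v => N (row_mx (0 : 'M_1) v)).
  split=> [|u v|c v]; first by rewrite row_mx0.
    by move=> hu hv; rewrite -[0]addr0 -add_row_mx; apply: ND.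
  by move=> hv; rewrite -[0](scaler0 _ c) -scale_row_mx; apply: NZ.
pose G : 'M_(p, 1 + r) := row_mx (\col_i g i) (\matrix_i w i).
pose D : 'M_(p + q, 1 + r) := col_mx G (row_mx 0 D').
have rowG i : row i G = row_mx ((g i)%:M : 'M_1) (w i).
  rewrite /G row_row_mx rowK; congr row_mx.
  by apply/rowP => j; rewrite !mxE !ord1 eqxx mulr1n.
have NG := row_submodule_mulmx hN (fun i => eq_ind_r N (hw i) (rowG i)).
exists (p + q)%N, D => v; split; last first.
  move=> [u ->]; rewrite -[u]hsubmxK mul_row_col; apply: ND; first exact: NG.
  by rewrite mul_mx_row mulmx0; apply/hD'; exists (rsubmx u).
rewrite -[v]hsubmxK; set a := lsubmx _; set b := rsubmx _ => Nv.
have [c hc] : exists c, a 0 0 = \sum_i c i * g i.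
  by apply/hg; exists b; rewrite -mx11_scalar.
have aE : a = (\row_i c i) *m (\col_i g i).
  apply/rowP => j; rewrite !ord1 hc mxE; by apply: eq_bigr => i _; rewrite !mxE.
have [d hd] : exists d, b - (\row_i c i) *m (\matrix_i w i) = d *m D'.
  apply/hD'; have -> : row_mx 0 (b - (\row_i c i) *m (\matrix_i w i)) =
      row_mx a b + (-1) *: ((\row_i c i) *m G).
    by rewrite /G mul_mx_row scale_row_mx add_row_mx -aE !scaleN1r subrr.
  by apply: ND => //; apply: NZ; apply: NG.
exists (row_mx (\row_i c i) d).
rewrite mul_row_col /G !mul_mx_row mulmx0 add_row_mx addr0 -aE -hd addrC subrK //.
Qed.

End HilbertBasis.

(** * Graded modules and minimal free resolutions *)

Section GradedModules.
Variables (K : fieldType) (m : nat) (G : nmodType) (w : 'I_m -> G).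
Local Notation A := {mpoly K[m]}.
Local Notation wdeg := (weighted_degree w).

Lemma weighted_degreeD a b : wdeg (a + b)%MM = wdeg a + wdeg b.
Proof.
rewrite /weighted_degree -big_split /=; apply: eq_bigr => i _.
by rewrite mnmDE mulrnDr.
Qed.

Lemma weighted_degree0 : wdeg 0%MM = 0.
Proof. by rewrite /weighted_degree big1 // => i _; rewrite mnm0E mulr0n. Qed.

(** A common interface for $S$, for $S[t]$ over $T$, and for free modules of rows. The grading is
    used through the projections [pr] onto components. *)
Record graded_module (X : zmodType) (act : A -> X -> X) (comp : G -> X -> Prop)
    (pr : G -> X -> X) : Prop := GradedModule {
  gactDl : forall p q x, act (p + q) x = act p x + act q x;
  gactDr : forall p x y, act p (x + y) = act p x + act p y;
  gactM : forall p q x, act (p * q) x = act p (act q x);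
  gact1 : forall x, act 1 x = x;
  gcomp_act : forall d c a x, comp d x -> comp (wdeg a + d) (act (c *: 'X_[a]) x);
  gprD : forall d x y, pr d (x + y) = pr d x + pr d y;
  gpr_id : forall d x, comp d x -> pr d x = x;
  gpr_neq : forall d e x, comp d x -> d != e -> pr e x = 0 }.

Definition homog_row r (s : 'I_r -> G) d (v : 'rV[A]_r) : Prop :=
  forall j a, a \in msupp (v 0 j) -> wdeg a + s j = d.

Definition homog_part r (s : 'I_r -> G) d (v : 'rV[A]_r) : 'rV[A]_r :=
  \row_j mfilter (fun a => wdeg a + s j == d) (v 0 j).

Lemma homog_partP r (s : 'I_r -> G) d v : homog_row s d (homog_part s d v).
Proof. by move=> j a; rewrite mxE => /msupp_mfilter[/eqP]. Qed.

Lemma homog_part_id r (s : 'I_r -> G) d v : homog_row s d v -> homog_part s d v = v.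
Proof.
by move=> h; apply/rowP => j; rewrite mxE mfilter_id // => a /h->.
Qed.

Lemma homog_row0 r (s : 'I_r -> G) d : homog_row s d 0.
Proof. by move=> j a; rewrite mxE msupp0. Qed.

Lemma homog_rowD r (s : 'I_r -> G) d u v :
  homog_row s d u -> homog_row s d v -> homog_row s d (u + v).
Proof.
by move=> hu hv j a; rewrite mxE => /msuppD_le; rewrite mem_cat => /orP[/hu|/hv].
Qed.

Lemma homog_row_scale r (s : 'I_r -> G) d e (p : A) v :
  (forall a, a \in msupp p -> wdeg a + d = e) -> homog_row s d v ->
  homog_row s e (p *: v).
Proof.
move=> hp hv j a; rewrite mxE => /msuppM_le/allpairsP[[b c] /= [/hp hb /hv hc ->]].
by rewrite weighted_degreeD -addrA hc.
Qed.

Lemma homog_row_mulmx r q (s : 'I_r -> G) (t : 'I_q -> G) (D : 'M_(q, r)) d u :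
  (forall i j a, a \in msupp (D i j) -> wdeg a + s j = t i) ->
  homog_row t d u -> homog_row s d (u *m D).
Proof.
move=> hD hu; rewrite mulmx_sum_row; apply: (big_ind (homog_row s d)).
- exact: homog_row0.
- exact: homog_rowD.
move=> i _; apply: (@homog_row_scale _ s (t i)); first by move=> a /hu.
by move=> j a; rewrite mxE; apply: hD.
Qed.

Lemma row_graded_module r (s : 'I_r -> G) :
  graded_module (fun (p : A) (v : 'rV_r) => p *: v) (homog_row s) (homog_part s).
Proof.
split=> //.
- by move=> p q x; rewrite scalerDl.
- by move=> p x y; rewrite scalerDr.
- by move=> p q x; rewrite scalerA.
- by move=> x; rewrite scale1r.
- move=> d c a x; apply: homog_row_scale => b /msuppZ_le.
  by rewrite msuppX inE => /eqP->.
- by move=> d x y; apply/rowP => j; rewrite !mxE raddfD.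
- by move=> d x /homog_part_id.
move=> d e x h /eqP de; apply/rowP => j; rewrite !mxE mfilter_eq0 // => a /h ->.
exact/eqP.
Qed.

Section Module.
Variables (X : zmodType) (act : A -> X -> X) (comp : G -> X -> Prop) (pr : G -> X -> X).
Hypothesis gX : graded_module act comp pr.

Definition lincomb r (x : 'I_r -> X) (v : 'rV[A]_r) : X := \sum_j act (v 0 j) (x j).

Lemma act0l x : act 0 x = 0.
Proof. by apply: (addrI (act 0 x)); rewrite -(gactDl gX) !addr0. Qed.

Lemma act0r p : act p 0 = 0.
Proof. by apply: (addrI (act p 0)); rewrite -(gactDr gX) !addr0. Qed.

Lemma gpr0 d : pr d 0 = 0.
Proof. by apply: (addrI (pr d 0)); rewrite -(gprD gX) !addr0. Qed.

Lemma act_suml (T : Type) (r : seq T) (P : pred T) F x :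
  act (\sum_(i <- r | P i) F i) x = \sum_(i <- r | P i) act (F i) x.
Proof. by apply: (big_morph (act^~ x)) => [p q|]; rewrite ?act0l ?(gactDl gX). Qed.

Lemma act_sumr (T : Type) (r : seq T) (P : pred T) F p :
  act p (\sum_(i <- r | P i) F i) = \sum_(i <- r | P i) act p (F i).
Proof. by apply: (big_morph (act p)) => [x y|]; rewrite ?act0r ?(gactDr gX). Qed.

Lemma gpr_sum (T : Type) (r : seq T) (P : pred T) F d :
  pr d (\sum_(i <- r | P i) F i) = \sum_(i <- r | P i) pr d (F i).
Proof. by apply: (big_morph (pr d)) => [x y|]; rewrite ?gpr0 ?(gprD gX). Qed.

Lemma lincombD r (x : 'I_r -> X) u v : lincomb x (u + v) = lincomb x u + lincomb x v.
Proof.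
by rewrite /lincomb -big_split; apply: eq_bigr => j _; rewrite mxE (gactDl gX).
Qed.

Lemma lincombZ r (x : 'I_r -> X) p v : lincomb x (p *: v) = act p (lincomb x v).
Proof.
by rewrite /lincomb act_sumr; apply: eq_bigr => j _; rewrite mxE (gactM gX).
Qed.

Lemma lincomb0 r (x : 'I_r -> X) : lincomb x 0 = 0.
Proof. by rewrite /lincomb big1 // => j _; rewrite mxE act0l. Qed.

Lemma lincomb_delta r (x : 'I_r -> X) j : lincomb x (delta_mx 0 j) = x j.
Proof.
rewrite /lincomb (bigD1 j) //= mxE !eqxx (gact1 gX) big1 ?addr0 // => i /negPf ij.
by rewrite mxE ij andbF act0l.
Qed.

(** A monomial of exponent [a] in the entry [v 0 j] contributes in degree [wdeg a + s j] only.
    Consequently homogeneous parts of relations are relations. *)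
Lemma pr_lincomb r (s : 'I_r -> G) (x : 'I_r -> X) d v :
  (forall j, comp (s j) (x j)) -> pr d (lincomb x v) = lincomb x (homog_part s d v).
Proof.
move=> hx; rewrite /lincomb gpr_sum; apply: eq_bigr => j _.
rewrite {1}[v 0 j]mpolyE act_suml gpr_sum mxE /mfilter act_suml [RHS]big_mkcond /=.
apply: eq_bigr => a _; have hc := gcomp_act gX ((v 0 j)@_a) a (hx j).
case: eqP => [e|/eqP e]; last by rewrite (gpr_neq gX hc).
by rewrite (gpr_id gX) // -e.
Qed.

Definition homog_generators r (s : 'I_r -> G) (x : 'I_r -> X) (M : X -> Prop) : Prop :=
  (forall j, comp (s j) (x j)) /\ forall b, M b <-> exists v, b = lincomb x v.

Lemma homog_generators_fin (T : finType) (s : T -> G) (x : T -> X) (M : X -> Prop) :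
  (forall t, comp (s t) (x t)) ->
  (forall b, M b <-> exists v : T -> A, b = \sum_t act (v t) (x t)) ->
  homog_generators (fun j : 'I_#|T| => s (enum_val j)) (fun j => x (enum_val j)) M.
Proof.
move=> hx hM; split=> // b; rewrite hM; split=> [[v ->]|[v ->]].
  exists (\row_j v (enum_val j)); rewrite /lincomb (reindex (@enum_val T T)) /=.
    by apply: eq_bigr => j _; rewrite mxE.
  exact/onW_bij/enum_val_bij.
exists (fun t => v 0 (enum_rank t)); rewrite /lincomb [RHS](reindex (@enum_val T T)) /=.
  by apply: eq_bigr => j _; rewrite enum_valK.
exact/onW_bij/enum_val_bij.
Qed.

(** Minimality in Nakayama's form: relations have all coefficients in the ideal of the variables. *)
Definition minimal_relations r (x : 'I_r -> X) : Prop :=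
  forall v, lincomb x v = 0 -> forall j, (v 0 j)@_0%MM = 0.

Hypothesis addIG : forall a b c : G, a + c = b + c -> a = b.
Hypothesis w_pos : forall a, wdeg a = 0 -> a = 0%MM.

(** A generating family of least cardinality works: a relation with a nonzero constant term at [j0]
    would allow [x j0] to be eliminated. *)
Lemma minimal_homog_generators (M : X -> Prop) :
  (exists r (s : 'I_r -> G) x, homog_generators s x M) ->
  exists r (s : 'I_r -> G) x, homog_generators s x M /\ minimal_relations x.
Proof.
move=> /ex_min_nat[r [s [x [hx hM]]] rmin]; exists r, s, x; split=> // v v0 j0.
case: r s x hx hM v v0 j0 rmin => [|r] s x hx hM v v0 j0 rmin; first by case: j0.
apply/eqP/negP => /negP c0; set c := (_)@__ in c0.
suff /rmin : exists (s' : 'I_r -> G) x', homog_generators s' x' M by rewrite ltnn.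
pose v' := homog_part s (s j0) v.
have v'0 : lincomb x v' = 0 by rewrite -(pr_lincomb _ _ hx) v0 gpr0.
(* In degree [s j0] the entry at [j0] has weighted degree 0, so it is a constant by cancellation in
   [G] and [w_pos]. *)
have vj0 : v' 0 j0 = c%:MP.
  apply/mpolyP => a; rewrite mcoeffC mxE mcoeff_mfilter; case: eqP => [e|e].
    have -> : a = 0%MM by apply/w_pos/(@addIG _ _ (s j0)); rewrite e add0r.
    by rewrite eqxx mulr1.
  case: eqP => [a0|]; last by rewrite mulr0.
  by case: e; rewrite a0 weighted_degree0 add0r.
(* Scaled so that the coefficient at [j0] is -1: the relation then expresses [x j0] through the
   other generators. *)
pose u := (- c^-1)%:MP *: v'.
have uj0 : u 0 j0 = - 1.
  by rewrite mxE vj0 -mpolyCM mulNr mulVf // mpolyCN mpolyC1.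
have u0 : lincomb x u = 0 by rewrite lincombZ v'0 act0r.
have xj0 : x j0 = \sum_(j < r) act (u 0 (lift j0 j)) (x (lift j0 j)).
  move: u0; rewrite /lincomb (bigD1_ord j0) //= uj0 => e.
  have : act (-1) (x j0) + x j0 = 0.
    by rewrite -{2}(gact1 gX (x j0)) -(gactDl gX) addNr act0l.
  by move/eqP; rewrite addrC addr_eq0 => /eqP->; apply/eqP; rewrite eq_sym -addr_eq0 addrC e.
exists (fun j => s (lift j0 j)), (fun j => x (lift j0 j)); split=> // b.
rewrite hM; split=> [[t ->]|[t ->]].
  exists (\row_j (t 0 (lift j0 j) + t 0 j0 * u 0 (lift j0 j))).
  rewrite /lincomb (bigD1_ord j0) //= xj0 act_sumr -big_split /=.
  apply: eq_bigr => j _; by rewrite mxE (gactDl gX) addrC (gactM gX).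
exists (\row_j oapp (fun i => t 0 i) 0 (unlift j0 j)).
rewrite /lincomb [RHS](bigD1_ord j0) //= !mxE unlift_none /= act0l add0r.
by apply: eq_bigr => j _; rewrite mxE liftK.
Qed.

Lemma relations_submodule r (x : 'I_r -> X) : row_submodule (fun v => lincomb x v = 0).
Proof.
split=> [|u v hu hv|p v hv]; first exact: lincomb0.
  by rewrite lincombD hu hv addr0.
by rewrite lincombZ hv act0r.
Qed.

Lemma relations_graded r (s : 'I_r -> G) (x : 'I_r -> X) d v :
  (forall j, comp (s j) (x j)) -> lincomb x v = 0 -> lincomb x (homog_part s d v) = 0.
Proof. by move=> hx hv; rewrite -pr_lincomb // hv gpr0. Qed.

End Module.

Lemma homog_part_sum r (s : 'I_r -> G) (ds : seq G) (v : 'rV[A]_r) : uniq ds ->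
  (forall j a, a \in msupp (v 0 j) -> wdeg a + s j \in ds) ->
  v = \sum_(d <- ds) homog_part s d v.
Proof.
move=> uds h; apply/rowP => j; apply/mpolyP => a; rewrite summxE raddf_sum /=.
under eq_bigr => d _ do rewrite mxE mcoeff_mfilter.
have [av|av] := boolP (a \in msupp (v 0 j)); last first.
  by rewrite (memN_msupp_eq0 av) big1 // => d _; case: eqP.
rewrite (bigD1_seq (wdeg a + s j)) ?h //= eqxx big1 ?addr0 // => d /negPf.
by rewrite eq_sym => ->.
Qed.

(** The homogeneous components of finitely many generators lie in [N] and generate it; only the
    finitely many degrees in [ds] occur. *)
Lemma graded_submodule_generators r (s : 'I_r -> G) (N : 'rV[A]_r -> Prop) :
  row_submodule N -> (forall d v, N v -> N (homog_part s d v)) ->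
  exists p (t : 'I_p -> G) x, homog_generators (fun (p : A) (v : 'rV_r) => p *: v)
    (homog_row s) t x N.
Proof.
move=> hN hg; have [p [D hD]] := hilbert_basis hN; have [N0 ND NZ] := hN.
pose ds := undup (flatten [seq [seq wdeg a + s ij.2 | a <- msupp (D ij.1 ij.2)]
                          | ij : 'I_p * 'I_r]).
have hds i j a : a \in msupp (D i j) -> wdeg a + s j \in ds.
  move=> ha; rewrite mem_undup; apply/flattenP.
  exists [seq wdeg a + s j | a <- msupp (D i j)]; last exact: map_f.
  by apply/imageP; exists (i, j).
have := @homog_generators_fin _ (fun (p : A) (v : 'rV_r) => p *: v) (homog_row s)
   ('I_p * 'I_(size ds))%type
  (fun ik => tnth (in_tuple ds) ik.2)
  (fun ik => homog_part s (tnth (in_tuple ds) ik.2) (row ik.1 D)) N.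
have Nrow i : N (row i D) by apply/hD; exists (delta_mx 0 i); rewrite rowE.
move=> h; do 3!eexists; apply: h => [[i k]|b]; first exact: homog_partP.
split=> [/hD[u ->]|[v ->]]; last first.
  by apply: (big_ind N) => // ik _; apply: NZ; apply: hg.
exists (fun ik => u 0 ik.1); rewrite mulmx_sum_row -(pair_bigA _
  (fun i k => u 0 i *: homog_part s (tnth (in_tuple ds) k) (row i D))) /=.
apply: eq_bigr => i _; rewrite -scaler_sumr; congr (_ *: _).
rewrite -(big_tuple _ _ (in_tuple ds) xpredT (fun d => homog_part s d (row i D))).
apply: homog_part_sum; first exact: undup_uniq.
by move=> j a; rewrite mxE; apply: hds.
Qed.

Lemma lincomb_scale r q (x : 'I_q -> 'rV[A]_r) v :
  lincomb (fun p u => p *: u) x v = v *m \matrix_i x i.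
Proof. by rewrite mulmx_sum_row; apply: eq_bigr => j _; rewrite rowK. Qed.

Lemma homog_part_mulmx r q (s : 'I_r -> G) (t : 'I_q -> G) (D : 'M[A]_(q, r)) d v :
  (forall i j a, a \in msupp (D i j) -> wdeg a + s j = t i) ->
  homog_part s d (v *m D) = homog_part t d v *m D.
Proof.
move=> hD; have DE : \matrix_i row i D = D by apply/row_matrixP => i; rewrite rowK.
have := pr_lincomb (row_graded_module s) (s := t) (x := fun i => row i D) d v.
by rewrite !lincomb_scale DE; apply=> i j a; rewrite mxE; apply: hD.
Qed.

Lemma homog_row_lift r q (s : 'I_r -> G) (t : 'I_q -> G) (D : 'M[A]_(q, r)) d v u :
  (forall i j a, a \in msupp (D i j) -> wdeg a + s j = t i) ->
  homog_row s d v -> v = u *m D -> exists u', homog_row t d u' /\ v = u' *m D.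
Proof.
move=> hD hv vE; exists (homog_part t d u); split; first exact: homog_partP.
by rewrite -(homog_part_mulmx _ _ hD) -vE homog_part_id.
Qed.

(** * Minimal free resolutions by iterated minimal covers *)

Section Existence.
Hypothesis addIG : forall a b c : G, a + c = b + c -> a = b.
Hypothesis w_pos : forall a, wdeg a = 0 -> a = 0%MM.

(** The ambient rank varies from one step to the next, so it is bundled with the submodule;
    [next_syzygy] can then be iterated. *)
Record syzygy_module := SyzygyModule {
  srank : nat;
  sshift : 'I_srank -> G;
  spred : 'rV[A]_srank -> Prop;
  ssub : row_submodule spred;
  sgraded : forall d v, spred v -> spred (homog_part sshift d v) }.

Definition syzygy_cover (M : syzygy_module) r (s : 'I_r -> G) (D : 'M[A]_(r, srank M)) :=
  [/\ forall i j a, a \in msupp (D i j) -> wdeg a + sshift j = s i,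
      forall v, spred v <-> exists u, v = u *m D
    & forall u : 'rV_r, u *m D = 0 -> forall j, (u 0 j)@_0%MM = 0].

Lemma syzygy_cover_ex M : exists c : {r & (('I_r -> G) * 'M[A]_(r, srank M))%type},
  syzygy_cover (projT2 c).1 (projT2 c).2.
Proof.
have /(minimal_homog_generators (row_graded_module _) addIG w_pos) :=
  graded_submodule_generators (@ssub M) (@sgraded M).
case=> r [s [x [[hx hM] hmin]]]; exists (existT _ r (s, \matrix_i x i)) => /=; split.
- by move=> i j a; rewrite mxE; apply: hx.
- by move=> v; rewrite hM; split=> -[u ->]; exists u; rewrite lincomb_scale.
by move=> u hu; apply: hmin; rewrite lincomb_scale.
Qed.

Definition cover M := proj1_sig (constructive_indefinite_description _ (syzygy_cover_ex M)).

Lemma coverP M : syzygy_cover (projT2 (cover M)).1 (projT2 (cover M)).2.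
Proof. by rewrite /cover; case: constructive_indefinite_description. Qed.

Lemma kernel_submodule r q (D : 'M[A]_(q, r)) : row_submodule (fun u : 'rV_q => u *m D = 0).
Proof.
split=> [|u v hu hv|c v hv]; first by rewrite mul0mx.
  by rewrite mulmxDl hu hv addr0.
by rewrite -scalemxAl hv scaler0.
Qed.

Lemma kernel_graded M d v :
  v *m (projT2 (cover M)).2 = 0 ->
  homog_part (projT2 (cover M)).1 d v *m (projT2 (cover M)).2 = 0.
Proof.
move=> v0; have [hD _ _] := coverP M.
rewrite -(homog_part_mulmx _ _ hD) v0; apply/homog_part_id/homog_row0.
Qed.

Definition next_syzygy M : syzygy_module :=
  SyzygyModule (kernel_submodule (projT2 (cover M)).2) (@kernel_graded M).

Variables (B : comNzRingType) (phi : {rmorphism A -> B}) (component : G -> B -> Prop).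
Variable pr : G -> B -> B.
Hypothesis gB : graded_module (fun p b => phi p * b) component pr.

Lemma minimal_free_resolution_ex (M : B -> Prop) :
  (exists r (s : 'I_r -> G) x,
     homog_generators (fun p b => phi p * b) component s x M) ->
  exists F, minimal_free_resolution w phi component M F.
Proof.
move=> /(minimal_homog_generators gB addIG w_pos)[r [s [x [[hx hM] hmin]]]].
pose S0 := SyzygyModule (relations_submodule gB x)
  (fun d v => @relations_graded _ _ _ _ gB _ s x d v hx).
pose st i := iter i next_syzygy S0.
exists (FreeComplex (fun i j => @sshift (st i) j) x (fun i => (projT2 (cover (st i))).2)).
split=> //=.
- by move=> i; have [] := coverP (st i).
- by move=> v; have [_ h _] := coverP S0; apply: h.
- by move=> i v; have [_ h _] := coverP (st i.+1); apply: h.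
(* Each module in the sequence consists of relations among minimal generators. The rows of
   [diff F i] belong to the [i]-th one, which gives minimality. *)
have hst i v : @spred (st i) v -> forall j, (v 0 j)@_0%MM = 0.
  by case: i v => [|i] v /=; [apply: hmin | have [_ _] := coverP (st i); apply].
move=> i j l; have [_ h _] := coverP (st i).
have /hst/(_ l) : @spred (st i) (row j (projT2 (cover (st i))).2).
  by apply/h; exists (delta_mx 0 j); rewrite rowE.
by rewrite mxE.
Qed.

End Existence.

End GradedModules.

(** * Hilbert's syzygy theorem and existence of the regularity *)

Section SyzygyTheorem.
Variables (K : fieldType) (m : nat).
Local Notation A := {mpoly K[m]}.

Definition low_mnm k (a : 'X_{1..m}) := [exists i : 'I_m, (i < k)%N && (a i != 0%N)].

(** The ideal $(x_0,\dots,x_{k-1})$, described by supports. *)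
Definition low_ideal k (p : A) : Prop := {in msupp p, forall a, low_mnm k a}.

Lemma low_idealP k p : low_ideal k p <-> forall a, ~~ low_mnm k a -> p@_a = 0.
Proof.
split=> h a; first by move=> na; apply/eqP; rewrite mcoeff_eq0; apply: contra na; apply: h.
by rewrite mcoeff_msupp; apply: contraR => /h->.
Qed.

Lemma low_mnmD k a b : low_mnm k b -> low_mnm k (a + b)%MM.
Proof.
move=> /existsP[i /andP[ik bi]]; apply/existsP; exists i.
by rewrite ik mnmDE addn_eq0 negb_and bi orbT.
Qed.

Lemma low_idealD k p q : low_ideal k p -> low_ideal k q -> low_ideal k (p + q).
Proof. by move=> hp hq a /msuppD_le; rewrite mem_cat => /orP[/hp|/hq]. Qed.

Lemma low_idealM k p q : low_ideal k q -> low_ideal k (p * q).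
Proof. by move=> hq a /msuppM_le/allpairsP[[b c] /= [_ /hq h ->]]; apply: low_mnmD. Qed.

(** The variables form a regular sequence: whether some $x_i$ with $i<k$ divides a monomial is
    unaffected by a factor $x_k$. *)
Lemma low_ideal_mulX (k : 'I_m) p : low_ideal k ('X_k * p) -> low_ideal k p.
Proof.
move=> /low_idealP h; apply/low_idealP => a na.
rewrite -(mcoeffMX _ U_(k)) mulrC h //; apply: contra na => /existsP[i /andP[ik]].
rewrite mnmDE mnm1E => ai; apply/existsP; exists i; rewrite ik /=; move: ai.
by rewrite (_ : k == i = false) ?addn0 //; apply/eqP => ki; rewrite ki ltnn in ik.
Qed.

Lemma low_idealS_mulX (k : 'I_m) p : low_ideal k.+1 ('X_k * p).
Proof.
rewrite mulrC; apply: low_idealM => a; rewrite msuppX inE => /eqP->.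
by apply/existsP; exists k; rewrite ltnSn mnm1E eqxx.
Qed.

Lemma low_idealS k p : low_ideal k p -> low_ideal k.+1 p.
Proof.
move=> h a /h/existsP[i /andP[ik ai]]; apply/existsP; exists i.
by rewrite (ltn_trans ik).
Qed.

Lemma low_idealS_split (k : 'I_m) p : low_ideal k.+1 p ->
  exists q, low_ideal k (p - 'X_k * q).
Proof.
move=> h; pose P a := ~~ low_mnm k a.
exists (\sum_(a <- msupp p | P a) p@_a *: 'X_[a - U_(k)]).
have -> : 'X_k * (\sum_(a <- msupp p | P a) p@_a *: 'X_[a - U_(k)]) = mfilter P p.
  rewrite mulr_sumr; rewrite /mfilter big_seq_cond [RHS]big_seq_cond.
  apply: eq_bigr => a /andP[/h la Pa]; rewrite -scalerAr -mpolyXD addmC submK //.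
  rewrite lep1mP; case/existsP: la => i /andP[]; rewrite ltnS leq_eqVlt => /orP[/eqP e|ik] ai.
    by rewrite -(_ : i = k) //; apply: val_inj.
  by case/negP: Pa; apply/existsP; exists i; rewrite ik.
by apply/low_idealP => a na; rewrite mcoeffB mcoeff_mfilter /P na subrr.
Qed.

Definition low_row k r (v : 'rV[A]_r) : Prop := forall j, low_ideal k (v 0 j).

Lemma low_rowD k r (u v : 'rV[A]_r) : low_row k u -> low_row k v -> low_row k (u + v).
Proof. by move=> hu hv j; rewrite mxE; apply: low_idealD. Qed.

Lemma low_row_mulmx k r q (u : 'rV[A]_r) (D : 'M_(r, q)) : low_row k u -> low_row k (u *m D).
Proof.
move=> hu j; rewrite mxE; apply: (big_ind (low_ideal k)).
- by move=> a; rewrite msupp0.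
- exact: low_idealD.
by move=> i _; rewrite mulrC; apply: low_idealM.
Qed.

Lemma low_rowN k r (v : 'rV[A]_r) : low_row k v -> low_row k (- v).
Proof.
by move=> hv j; rewrite mxE -mulN1r; apply: low_idealM.
Qed.

Variables (rk : nat -> nat) (D : forall i, 'M[A]_(rk i.+1, rk i)).
Hypothesis exactD : forall i (v : 'rV_(rk i.+1)),
  v *m D i = 0 <-> exists u, v = u *m D i.+1.

Lemma exact_mulmx0 i : D i.+1 *m D i = 0.
Proof.
apply/row_matrixP => j; rewrite row_mul row0; apply/exactD.
by exists (delta_mx 0 j); rewrite rowE.
Qed.

(* Killing one more variable, a nonzerodivisor modulo the previous ones, costs *)
(* exactness in one homological degree.                                       *)
Lemma exact_mod_low k i (v : 'rV_(rk i.+1)) : (k <= i)%N -> (k <= m)%N ->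
  low_row k (v *m D i) -> exists u, low_row k (v - u *m D i.+1).
Proof.
elim: k i v => [|k IH] i v ki km hv.
  have /exactD[u ->] : v *m D i = 0.
    apply/rowP => j; rewrite [RHS]mxE; apply/mpolyP => a; rewrite mcoeff0.
    by move/low_idealP: (hv j); apply; apply/existsP => -[].
  by exists u; rewrite subrr => j a; rewrite mxE msupp0.
case: i v ki hv => // i v ki hv; pose x := Ordinal km.
have /choice_fun[f hf] : forall j, exists q, low_ideal k ((v *m D i.+1) 0 j - 'X_x * q).
  by move=> j; apply: (@low_idealS_split x).
pose w := \row_j f j.
have hw : low_row k (v *m D i.+1 - 'X_x *: w).
  by move=> j; have := hf j; move: (v *m D i.+1) => u; rewrite !mxE.
(* Modulo the first $k$ variables, $vD=x_kw$. Applying the next differential kills the left side, so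
   $x_k(wD)$ vanishes there, and $x_k$ cancels. *)
have : low_row k (w *m D i).
  move=> j; apply: (@low_ideal_mulX x).
  have := low_rowN (@low_row_mulmx _ _ _ _ (D i) hw).
  rewrite mulmxBl -mulmxA exact_mulmx0 mulmx0 sub0r opprK -scalemxAl => /(_ j).
  by rewrite mxE.
move=> /IH[//||z hz]; first exact: ltnW.
(* As $w$ is a boundary $zD$ modulo the first $k$ variables, correcting $v$ by $x_kz$ gives a cycle
   there; the induction hypothesis applies a second time. *)
have : low_row k ((v - 'X_x *: z) *m D i.+1).
  have -> : (v - 'X_x *: z) *m D i.+1 =
      (v *m D i.+1 - 'X_x *: w) + 'X_x *: (w - z *m D i.+1).
    by rewrite mulmxBl -scalemxAl scalerBr addrA subrK.
  by apply: low_rowD => // j; rewrite mxE; apply: low_idealM.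
move=> /IH[||u hu]; [exact: ltnW|exact: ltnW|].
exists u; have -> : v - u *m D i.+2 = v - 'X_x *: z - u *m D i.+2 + 'X_x *: z.
  by rewrite -addrA addrAC -!addrA subrr addr0.
apply: low_rowD => j; first exact: low_idealS.
by rewrite mxE; apply: (@low_idealS_mulX x).
Qed.

Hypothesis minD : forall i j l, (D i j l)@_0%MM = 0.

Lemma low_ideal_full p : low_ideal m p <-> p@_0%MM = 0.
Proof.
rewrite low_idealP; split=> [|h a na]; first apply.
  by apply/existsP => -[i]; rewrite mnm0E eqxx andbF.
suff -> : a = 0%MM by [].
apply/mnmP => i; rewrite mnm0E; apply/eqP; apply: contraNT na => ai.
by apply/existsP; exists i; rewrite ltn_ord.
Qed.

(** Modulo all $m$ variables the differentials vanish, yet exactness persists beyond degree $m$. A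
    basis vector would then be congruent to a boundary, hence to 0, although it has an entry 1. *)
Lemma minimal_exact_rank0 i : (m < i)%N -> rk i = 0%N.
Proof.
case: i => // i mi; apply/eqP; rewrite -leqn0 leqNgt; apply/negP => r0.
pose j : 'I_(rk i.+1) := Ordinal r0.
have low_D l (u : 'rV_(rk l.+1)) : low_row m (u *m D l).
  move=> a; rewrite mxE; apply: (big_ind (low_ideal m)).
  - by move=> b; rewrite msupp0.
  - exact: low_idealD.
  by move=> b _; apply: low_idealM; apply/low_ideal_full.
have [//|//||u hu] := @exact_mod_low m i (delta_mx 0 j); first exact: low_D.
have /(_ j)/low_ideal_full/eqP := low_rowD hu (low_D _ u).
by rewrite subrK mxE !eqxx mcoeff1 eqxx oner_eq0.
Qed.

End SyzygyTheorem.

(** * Existence of the regularity *)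

Section RegularityExists.
Variables (K : fieldType) (m : nat) (G : nmodType) (w : 'I_m -> G).
Local Notation A := {mpoly K[m]}.
Hypothesis addIG : forall a b c : G, a + c = b + c -> a = b.
Hypothesis w_pos : forall a, weighted_degree w a = 0 -> a = 0%MM.
Variables (B : comNzRingType) (phi : {rmorphism A -> B}) (component : G -> B -> Prop).
Variable pr : G -> B -> B.
Hypothesis gB : graded_module w (fun p b => phi p * b) component pr.
Variable M : B -> Prop.
Hypothesis M_fg : exists r (s : 'I_r -> G) x,
  homog_generators (fun p b => phi p * b) component s x M.
Hypothesis M_neq0 : exists2 b, M b & b != 0.

(** The maximum defining the regularity runs over a nonempty finite set: $F_0\ne0$ because the
    module is nonzero, and $F_i=0$ for $i>m$. *)
Lemma regularityP (deg : G -> nat) :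
  is_regularity w phi component M deg (regularity w phi component M deg).
Proof.
apply: epsilon_spec; have [F hF] := minimal_free_resolution_ex addIG w_pos gB M_fg.
have rk0 := minimal_exact_rank0 (exact_at_S hF) (diff_minimal hF).
have j0 : 'I_(rank F 0).
  suff r0 : (0 < rank F 0)%N by exact: Ordinal r0.
  rewrite lt0n; apply/eqP => e.
  case: M_neq0 => b /(aug_image hF)[v ->]; rewrite /augmentation big1 ?eqxx // => j.
  by case: (eq_rect _ (fun r => 'I_r) j _ e).
pose T := {i : 'I_m.+1 & 'I_(rank F i)}.
pose t0 : T := Tagged (fun i : 'I_m.+1 => 'I_(rank F i)) (j0 : 'I_(rank F (ord0 : 'I_m.+1))).
(* Adding $m$ to $\deg-i$ keeps the values in [nat]; the subtraction does not truncate, since $i\le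
   m$ on [T]. *)
pose f (t : T) := (deg (shift F (tag t) (tagged t)) + (m - tag t))%N.
have [t _ tmax] := @arg_maxnP T t0 xpredT f isT.
exists ((f t)%:Z - m%:Z), F; split=> //.
  exists (tag t), (tagged t); rewrite /f; have := ltn_ord (tag t); rewrite ltnS => le.
  by rewrite PoszD -subzn //; ring.
move=> i j; have im : (i < m.+1)%N.
  by rewrite ltnS leqNgt; apply/negP => /rk0 e; case: (eq_rect _ (fun r => 'I_r) j _ e).
have := tmax (Tagged (fun i : 'I_m.+1 => 'I_(rank F i)) (j : 'I_(rank F (Ordinal im)))) isT.
by rewrite /f /=; lia.
Qed.

End RegularityExists.

(** * Comparison with a resolution by projectives *)

Lemma row_factor (R : pzRingType) p q r (M : 'M[R]_(p, r)) (D : 'M_(q, r)) :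
  (forall l, exists u, row l M = u *m D) -> exists s, M = s *m D.
Proof.
move=> /choice_fun[f hf]; exists (\matrix_l f l).
by apply/row_matrixP => l; rewrite hf row_mul rowK.
Qed.

Lemma weighted_degree1 n (a : 'X_{1..n}) : weighted_degree (fun=> 1%N) a = mdeg a.
Proof. by rewrite /weighted_degree mdegE; apply: eq_bigr => i _; rewrite -[RHS]natn. Qed.

Section Comparison.
Variables (K : fieldType) (n : nat) (L : {mpoly K[n]} -> Prop).
Local Notation S := {mpoly K[n]}.
Variable F : free_complex K n nat S.
Hypothesis hF : standard_resolution L F.

(* C_i is the S-submodule inC i of T^(rk i), with S acting through iota; T is *)
(* S itself for an S-resolution, and K[x, y] for a strand of a T-resolution.  *)
Variables (T : comNzRingType) (iota : {rmorphism S -> T}).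
Variables (rk : nat -> nat) (D : forall i, 'M[T]_(rk i.+1, rk i)).
Variables (inC : forall i, 'rV[T]_(rk i) -> Prop) (homC : forall i, nat -> 'rV[T]_(rk i) -> Prop).
Variable augC : 'rV[T]_(rk 0) -> S.
Arguments inC : clear implicits.
Arguments homC : clear implicits.

Hypothesis homC_in : forall i d v, homC i d v -> inC i v.
Hypothesis homC0 : forall i d, homC i d 0.
Hypothesis homCD : forall i d u v, homC i d u -> homC i d v -> homC i d (u + v).
Hypothesis homC_scale : forall i c d p v, p \is c.-homog -> homC i d v ->
  homC i (c + d)%N (iota p *: v).
Hypothesis inC_D : forall i v, inC i.+1 v -> inC i (v *m D i).
Hypothesis DD : forall i, D i.+1 *m D i = 0.
Hypothesis exactC : forall i d v, homC i.+1 d v -> v *m D i = 0 ->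
  exists u, homC i.+2 d u /\ v = u *m D i.+1.
Hypothesis augCD : forall u v, augC (u + v) = augC u + augC v.
Hypothesis augCZ : forall p v, augC (iota p *: v) = p * augC v.
Hypothesis augC_onto : forall f d, L f -> f \is d.-homog -> exists v, homC 0 d v /\ augC v = f.
Hypothesis augC_in : forall v, inC 0 v -> L (augC v).
Hypothesis augC_D : forall v, inC 1 v -> augC (v *m D 0) = 0.
Hypothesis exactC0 : forall d v, homC 0 d v -> augC v = 0 ->
  exists u, homC 1 d u /\ v = u *m D 0.

(* Only projectivity of C_i is needed: kappa i is a dual basis for e i.       *)
Variables (J : nat -> finType) (e : forall i, J i -> 'rV[T]_(rk i)).
Variable kappa : forall i, 'rV[T]_(rk i) -> J i -> S.
Arguments e : clear implicits.
Arguments kappa : clear implicits.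
Hypothesis kappaD : forall i u v j, kappa i (u + v) j = kappa i u j + kappa i v j.
Hypothesis kappaZ : forall i p v j, kappa i (iota p *: v) j = p * kappa i v j.
Hypothesis kappaP : forall i v, inC i v -> v = \sum_j iota (kappa i v j) *: e i j.
Hypothesis inC_e : forall i j, inC i (e i j).
Variable b : nat.
Hypothesis kappa_deg : forall i d v j a, homC i d v -> a \in msupp (kappa i v j) ->
  (d <= mdeg a + (i + b))%N.

Local Notation augF := (@augmentation K n nat S id F).

Definition iota_linear r p (f : 'rV[T]_r -> 'rV[S]_p) : Prop :=
  (forall u v, f (u + v) = f u + f v) /\ (forall c v, f (iota c *: v) = c *: f v).

Lemma iota_linear0 r p (f : 'rV[T]_r -> 'rV[S]_p) : iota_linear f -> f 0 = 0.
Proof. by case=> fD _; apply: (addrI (f 0)); rewrite -fD !addr0. Qed.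

Lemma iota_linear_sum r p (f : 'rV[T]_r -> 'rV[S]_p) (Q : finType) c v : iota_linear f ->
  f (\sum_(j : Q) iota (c j) *: v j) = \sum_j c j *: f (v j).
Proof.
move=> hf; case: (hf) => fD fZ; rewrite (big_morph f fD (iota_linear0 hf)).
by apply: eq_bigr => j _; rewrite fZ.
Qed.

(** Projectivity through the dual basis: lifts are chosen on the [e i j] and extended with the
    coordinates [kappa]. *)
Lemma iota_linear_lift i p q (f : 'rV[T]_(rk i) -> 'rV[S]_p) (E : 'M_(q, p)) :
  iota_linear f -> (forall v, inC i v -> exists u, f v = u *m E) ->
  exists h, iota_linear h /\ forall v, inC i v -> h v *m E = f v.
Proof.
move=> hf hE; have /choice_fun[g hg] : forall j, exists u, f (e i j) = u *m E.
  by move=> j; apply: hE.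
exists (fun v => \sum_j kappa i v j *: g j); split; first split.
- by move=> u v; rewrite -big_split; apply: eq_bigr => j _; rewrite kappaD scalerDl.
- by move=> c v; rewrite scaler_sumr; apply: eq_bigr => j _; rewrite kappaZ scalerA.
move=> v /kappaP hv; rewrite [in RHS]hv (iota_linear_sum _ _ hf) mulmx_suml.
by apply: eq_bigr => j _; rewrite -scalemxAl hg.
Qed.

Lemma diff_diff i : diff F i.+1 *m diff F i = 0.
Proof. exact: exact_mulmx0 (exact_at_S hF) i. Qed.

Lemma const_mulmx0 p q r (M : 'M[S]_(p, q)) (N : 'M_(q, r)) j l :
  (forall a, (M j a)@_0%MM = 0) \/ (forall a, (N a l)@_0%MM = 0) -> ((M *m N) j l)@_0%MM = 0.
Proof.
move=> h; rewrite mxE raddf_sum big1 // => a _ /=.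
by rewrite rmorphM /=; case: h => ->; rewrite ?mul0r ?mulr0.
Qed.

(** The image under [alpha] of the boundary of the [j]-th basis element of $F_{i+1}$; the next map
    [alpha] must lift it through [D i]. *)
Definition push i (alpha : 'I_(rank F i) -> 'rV[T]_(rk i)) j :=
  \sum_l iota (diff F i j l) *: alpha l.

Lemma homC_push i alpha j : (forall l, homC i (shift F i l) (alpha l)) ->
  homC i (shift F i.+1 j) (push alpha j).
Proof.
move=> h; apply: (big_ind (homC i _)); [exact: homC0|by move=> *; apply: homCD|].
move=> l _; have [le|gt] := leqP (shift F i l) (shift F i.+1 j).
  rewrite -(subnK le); apply: homC_scale => //; apply/dhomogP => a /(diff_homogeneous hF) <-.
  by rewrite weighted_degree1 -[(_ + _)%R]/(_ + _)%N addnK.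
suff -> : diff F i j l = 0 by rewrite rmorph0 scale0r; apply: homC0.
apply: msuppnil0; case E : (msupp _) => [//|a s].
have /(diff_homogeneous hF) : a \in msupp (diff F i j l) by rewrite E mem_head.
by move=> eq; move: gt; rewrite -eq ltnNge leq_addl.
Qed.

(* beta alpha - 1 is null-homotopic: it is R + s D with R the composite of the *)
(* differential below with the previous homotopy.                             *)
Lemma comparison i : exists (alpha : 'I_(rank F i) -> 'rV[T]_(rk i))
  (beta : 'rV[T]_(rk i) -> 'rV[S]_(rank F i)) s R,
  [/\ iota_linear beta /\ (forall l, homC i (shift F i l) (alpha l)),
      forall j, exists u, homC i.+1 (shift F i.+1 j) u /\ push alpha j = u *m D i,
      forall v, inC i.+1 v -> exists u, beta (v *m D i) = u *m diff F i
    & [/\ \matrix_l beta (alpha l) = 1%:M + R + s *m diff F i, diff F i *m R = 0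
        & forall j l, (R j l)@_0%MM = 0]].
Proof.
elim: i => [|i [alpha [beta [s [R [[lb ha] hpush hbeta [hs dR R0]]]]]]].
  have Laug l : L (aug F l).
    apply/(aug_image hF); exists (delta_mx 0 l); rewrite /augmentation (bigD1 l) //=.
    rewrite mxE !eqxx mul1r big1 ?addr0 // => j /negPf jl.
    by rewrite mxE jl andbF mul0r.
  have /choice_fun[alpha ha] l := augC_onto (Laug l) (aug_homogeneous hF l).
  pose c : 'cV[S]_(rank F 0) := \col_l aug F l.
  have augE u : (u *m c) = \row__ augF u.
    apply/rowP => k; rewrite !mxE; apply: eq_bigr => l _; by rewrite mxE.
  pose f v : 'rV[S]_1 := \row__ augC v.
  have lf : iota_linear f.
    by split=> [u v|p v]; apply/rowP => k; rewrite !mxE ?augCD ?augCZ.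
  have [|beta [lb hbeta]] := @iota_linear_lift 0 _ _ f c lf.
    by move=> v /augC_in/(aug_image hF)[u hu]; exists u; rewrite augE /f hu.
  have augb v : inC 0 v -> augF (beta v) = augC v.
    by move=> /hbeta; rewrite augE => /rowP/(_ 0); rewrite !mxE.
  have aug_sum (Q : finType) (p : Q -> S) v :
      augC (\sum_j iota (p j) *: v j) = \sum_j p j * augC (v j).
    have a0 : augC 0 = 0 by apply: (addrI (augC 0)); rewrite -augCD !addr0.
    by rewrite (big_morph augC augCD a0); apply: eq_bigr => j _; rewrite augCZ.
  (* [beta alpha] and the identity have the same augmentation, so their difference has image in the
     boundaries. *)
  have [|s hs] := @row_factor _ _ _ _ ((\matrix_l beta (alpha l)) - 1%:M) (diff F 0).
    move=> l; apply/(exact_at_0 hF); have [/homC_in hl al] := ha l.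
    rewrite /augmentation (eq_bigr (fun j => (beta (alpha l)) 0 j * aug F j -
      (l == j)%:R * aug F j)); last by move=> j _; rewrite !mxE mulrBl.
    rewrite sumrB [X in X - _](augb _ hl) al (bigD1 l) //= eqxx mul1r big1 ?addr0 ?subrr //.
    by move=> j /negPf; rewrite eq_sym => ->; rewrite mul0r.
  exists alpha, beta, s, 0; split=> [|j|v hv|].
  - by split=> // l; have [] := ha l.
  - apply: exactC0; first by apply: homC_push => l; have [] := ha l.
    rewrite aug_sum (eq_bigr (fun l => row j (diff F 0) 0 l * aug F l)).
      by apply/(exact_at_0 hF); exists (delta_mx 0 j); rewrite rowE.
    by move=> l _; rewrite mxE; have [_ ->] := ha l.
  - by apply/(exact_at_0 hF); rewrite augb ?augC_D //; apply: inC_D.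
  split; [|by rewrite mulmx0|by move=> j l; rewrite mxE mcoeff0].
  by rewrite addr0 -hs addrC subrK.
have /choice_fun[alpha' ha'] := hpush.
have lf : iota_linear (fun v => beta (v *m D i)).
  by case: lb => bD bZ; split=> [u v|c v]; rewrite ?mulmxDl ?bD // -scalemxAl bZ.
have [beta' [lb' hb']] := iota_linear_lift lf hbeta.
have comm : (\matrix_l beta' (alpha' l)) *m diff F i = diff F i *m \matrix_l beta (alpha l).
  apply/row_matrixP => j; rewrite !row_mul rowK [RHS]mulmx_sum_row.
  have [/homC_in hj e1] := ha' j.
  rewrite hb' // -e1 (iota_linear_sum _ _ lb); apply: eq_bigr => l _.
  by rewrite rowK mxE.
(* With $d$ for [diff F i], the product of this matrix with $d$ is $d(1+R+sd)-d-dsd=dR=0$, so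
   exactness of [F] applies row by row. *)
have [|s' hs'] := @row_factor _ _ _ _
    ((\matrix_l beta' (alpha' l)) - 1%:M - diff F i *m s) (diff F i.+1).
  move=> l; apply/(exact_at_S hF); rewrite -row_mul !mulmxBl comm hs !mulmxDr.
  by rewrite mulmx1 mul1mx dR addr0 -mulmxA addrAC addrK subrr row0.
exists alpha', beta', s', (diff F i *m s); split=> [|j|v hv|].
- by split=> // l; have [] := ha' l.
- apply: exactC; first by apply: homC_push => l; have [] := ha' l.
  rewrite /push mulmx_suml.
  under eq_bigr => l _ do rewrite -scalemxAl -(proj2 (ha' l)) /push scaler_sumr.
  rewrite exchange_big big1 //= => k _.
  under eq_bigr => l _ do rewrite scalerA -rmorphM.
  rewrite -scaler_suml -rmorph_sum.
  have /matrixP/(_ j k) := diff_diff i; rewrite !mxE => ->.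
  by rewrite rmorph0 scale0r.
- apply/(exact_at_S hF); rewrite hb'; last exact: inC_D.
  by rewrite -mulmxA DD mulmx0 (iota_linear0 lb).
split; [|by rewrite mulmxA diff_diff mul0mx|].
  by rewrite -hs' -[RHS]addrA [X in _ = _ + X]addrC subrK addrC subrK.
by move=> j l; apply: const_mulmx0; left => a; apply: (diff_minimal hF).
Qed.

(** By minimality the diagonal entries of [beta alpha] $=1+R+sD$ have constant term 1. If the shift
    exceeded $i+b$, all coordinates [kappa] of [alpha l] would have only monomials of positive
    degree, and the diagonal entry at [l] would have constant term 0. *)
Lemma shift_le i (l : 'I_(rank F i)) : (shift F i l <= i + b)%N.
Proof.
have [alpha [beta [s [R [[lb ha] _ _ [hs _ R0]]]]]] := comparison i.
rewrite leqNgt; apply/negP => lt.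
have : ((\matrix_l beta (alpha l)) l l)@_0%MM = 1.
  rewrite hs mxE raddfD /= const_mulmx0; last by right=> a; apply: (diff_minimal hF).
  by rewrite !mxE raddfD /= R0 !addr0 eqxx mcoeff1 eqxx.
have hv := kappaP (homC_in (ha l)); rewrite mxE hv (iota_linear_sum _ _ lb) summxE raddf_sum.
rewrite big1 => [/eqP|j _]; first by rewrite eq_sym oner_eq0.
rewrite /= mxE rmorphM /= [X in X * _](_ : _ = 0) ?mul0r //.
apply/eqP; rewrite mcoeff_eq0; apply/negP => /(kappa_deg (ha l)).
by rewrite mdeg0 add0n leqNgt lt.
Qed.

End Comparison.

(** * Monomial ideals *)

Section IdealGen.
Variable R : comNzRingType.
Implicit Types (I X Y : R -> Prop) (f g : R).

Lemma ideal_gen_ideal X : is_ideal (ideal_gen X).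
Proof.
split=> [|f g [s [hs ->]] [t [ht ->]]|f g [s [hs ->]]].
- by exists [::]; rewrite big_nil; split.
- exists (s ++ t); rewrite big_cat; split=> // p; rewrite mem_cat => /orP[/hs|/ht] //.
exists [seq (f * p.1, p.2) | p <- s]; split; first by move=> p /mapP[q /hs h ->].
by rewrite big_map mulr_sumr; apply: eq_bigr => p _; rewrite mulrA.
Qed.

Lemma ideal_gen_in X f : X f -> ideal_gen X f.
Proof.
move=> Xf; exists [:: (1, f)]; rewrite big_seq1 mul1r; split=> // p.
by rewrite inE => /eqP->.
Qed.

Lemma ideal_gen_sub X I f : is_ideal I -> (forall g, X g -> I g) -> ideal_gen X f -> I f.
Proof.
move=> hI h [s [hs ->]]; rewrite big_seq_cond.
by apply: ideal_sum => // p; rewrite andbT => /hs/h; case: hI => _ _; apply.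
Qed.

Lemma ideal_powS I k f g : I f -> ideal_pow I k g -> ideal_pow I k.+1 (f * g).
Proof.
move=> If; have idS := ideal_gen_ideal
  (fun f => exists g : 'I_k.+1 -> R, (forall i, I (g i)) /\ f = \prod_i g i).
pose P g := ideal_pow I k.+1 (f * g).
apply: (@ideal_gen_sub _ P).
  split; rewrite /P; case: idS => S0 SD SM; first by rewrite mulr0.
    by move=> a b ha hb; rewrite mulrDr; apply: SD.
  by move=> a b hb; rewrite mulrCA; apply: SM.
move=> _ [h [hh ->]]; apply: ideal_gen_in.
exists (fun i => oapp h f (unlift ord0 i)); split.
  by move=> i; case: unliftP => [j|] _ /=.
rewrite big_ord_recl unlift_none /=; congr (_ * _).
by apply: eq_bigr => i _; rewrite liftK.
Qed.

Lemma ideal_pow0 I f : ideal_pow I 0 f.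
Proof.
have [_ _ h] := ideal_gen_ideal (fun f => exists g : 'I_0 -> R, (forall i, I (g i)) /\ f = \prod_i g i).
rewrite -[f]mulr1; apply: h; apply: ideal_gen_in.
by exists (fun=> 0); rewrite big_ord0; split=> // -[].
Qed.

Lemma ideal_pow_expr I k f : I f -> ideal_pow I k (f ^+ k).
Proof.
by move=> If; elim: k => [|k IH]; [apply: ideal_pow0|rewrite exprS; apply: ideal_powS].
Qed.

End IdealGen.

Lemma ideal_gen_supp (K : fieldType) n (X : {mpoly K[n]} -> Prop) f a :
  ideal_gen X f -> a \in msupp f -> exists g c, [/\ X g, c \in msupp g & (c <= a)%MM].
Proof.
case=> s [hs ->]; elim: s hs => [|p s IH] hs; first by rewrite big_nil msupp0.
rewrite big_cons => /msuppD_le; rewrite mem_cat => /orP[|/IH]; last first.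
  by apply=> q qs; apply: hs; rewrite inE qs orbT.
move=> /msuppM_le/allpairsP[[c d] /= [_ hd ->]]; exists p.2, d; split=> //.
  by apply: hs; apply: mem_head.
exact: lem_addl.
Qed.

(** * Minimal generators and regularity of monomial ideals *)

Section MonomialIdeals.
Variables (K : fieldType) (n : nat).
Local Notation S := {mpoly K[n]}.
Implicit Types (I L : S -> Prop) (u a c : 'X_{1..n}).

Definition monomial_ideal L : Prop :=
  is_ideal L /\ forall f, L f <-> forall a, a \in msupp f -> L 'X_[a].

Definition minimal_exponent L u : Prop :=
  L 'X_[u] /\ forall a, L 'X_[a] -> (a <= u)%MM -> a = u.

Lemma monomial_idealW L : is_ideal L ->
  (forall f, L f -> forall a, a \in msupp f -> L 'X_[a]) -> monomial_ideal L.
Proof.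
move=> hL h; split=> // f; split=> [|hf]; first exact: h.
rewrite [f]mpolyE big_seq_cond; apply: ideal_sum => // a; rewrite andbT => /hf La.
by rewrite -mul_mpolyC; case: hL => _ _; apply.
Qed.

Lemma monomial_ideal_up L a c : is_ideal L -> (a <= c)%MM -> L 'X_[a] -> L 'X_[c].
Proof. by case=> _ _ LM ac La; rewrite -(submK ac) mpolyXD; apply: LM. Qed.

Lemma mdeg_le a c : (a <= c)%MM -> (mdeg a <= mdeg c)%N.
Proof. by move=> /submK <-; rewrite mdegD leq_addl. Qed.

Lemma mdeg_le_eq a c : (a <= c)%MM -> (mdeg c <= mdeg a)%N -> a = c.
Proof.
move=> /submK e; rewrite -e mdegD -{2}[mdeg a]add0n leq_add2r leqn0 mdeg_eq0.
by move=> /eqP->; rewrite add0m.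
Qed.

Lemma minimal_exponent_below L a : L 'X_[a] ->
  exists2 u, minimal_exponent L u & (u <= a)%MM.
Proof.
have [d le_d] := ubnP (mdeg a); elim: d a le_d => // d IH a le_d La.
case: (classic (minimal_exponent L a)) => [ha|na]; first by exists a => //; apply: lepm_refl.
have [c [Lc ca ne]] : exists c, [/\ L 'X_[c], (c <= a)%MM & c <> a].
  apply: NNPP => h; apply: na; split=> // c Lc ca; apply: NNPP => ne; apply: h.
  by exists c.
have [||u hu uc] := IH c => //; last by exists u => //; apply: lepm_trans uc ca.
rewrite ltnS in le_d; apply: leq_trans le_d; rewrite ltnNge; apply/negP.
by move=> /(mdeg_le_eq ca).
Qed.

Definition minimal_monomials L (f : S) : Prop := exists2 u, minimal_exponent L u & f = 'X_[u].

Lemma minimal_monomials_generate L : monomial_ideal L ->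
  minimally_generates (minimal_monomials L) L.
Proof.
move=> [idL hL]; have gen f : L f -> ideal_gen (minimal_monomials L) f.
  have [idG hG] : monomial_ideal (ideal_gen (minimal_monomials L)).
    apply: monomial_idealW; first exact: ideal_gen_ideal.
    move=> g gg a /(ideal_gen_supp gg)[_ [c [[u hu ->]]]].
    rewrite msuppX inE => /eqP-> /monomial_ideal_up; apply; first exact: ideal_gen_ideal.
    by apply: ideal_gen_in; exists u.
  move=> /hL Lf; apply/hG => a /Lf/minimal_exponent_below[u hu ua].
  apply: (monomial_ideal_up (ideal_gen_ideal _) ua).
  by apply: ideal_gen_in; exists u.
split=> [f|Y hY gY f [u hu ->]].
  by split=> [/gen //|]; apply: ideal_gen_sub => // g [u [Lu _] ->].
have /gY hg : L 'X_[u] by case: hu.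
have [|g [c [Yg]]] := ideal_gen_supp hg (a := u); first by rewrite msuppX mem_head.
have [v [Lv _] gv] := hY _ Yg; rewrite gv msuppX inE => /eqP-> vu.
by case: hu => _ /(_ _ Lv vu) <-; rewrite -gv.
Qed.

Lemma generated_without L X g : minimally_generates X L ->
  ideal_gen (fun f => X f /\ f <> g) g -> ~ X g.
Proof.
move=> [gX minX] hg Xg; pose Y f := X f /\ f <> g.
have [] : Y g; last by [].
apply: minX => //; first by move=> f [].
move=> f; rewrite gX; split; last first.
  apply: ideal_gen_sub; [exact: ideal_gen_ideal|move=> h [Xh _]; exact: ideal_gen_in].
apply: ideal_gen_sub; first exact: ideal_gen_ideal.
move=> h Xh; case: (classic (h = g)) => [->//|hne]; exact: ideal_gen_in.
Qed.

(** Every monomial of [L] dividing ['X_[u]] is a multiple of a generator ['X_[v]]; if [v] differed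
    from [u], then ['X_[u]] would be redundant. *)
Lemma minimal_monomial_generatorP L u : monomial_ideal L ->
  minimal_monomial_generator L u <-> minimal_exponent L u.
Proof.
move=> hL; split=> [[X [monX mX Xu]]|hu]; last first.
  exists (minimal_monomials L); split; last by exists u.
    by move=> f [v _ ->]; exists v.
  exact: minimal_monomials_generate.
have [gX _] := mX; split=> [|a /gX La au]; first exact/gX/ideal_gen_in.
have [|g [c [Xg cg ca]]] := ideal_gen_supp La (a := a).
  by rewrite msuppX mem_head.
have [v gv] := monX _ Xg; move: cg; rewrite gv msuppX inE => /eqP cv.
case: (eqVneq v u) => [vu|vu].
  by apply: mdeg_le_eq => //; apply: mdeg_le; rewrite -vu -cv.
case: (generated_without mX _ Xu).
have vle : (v <= u)%MM by apply: lepm_trans au; rewrite -cv.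
apply: (monomial_ideal_up (ideal_gen_ideal _) vle); apply: ideal_gen_in; split.
  by rewrite -gv.
move=> /(congr1 (mcoeff u)); rewrite !mcoeffX eqxx (negPf vu) => /eqP.
by rewrite eq_sym oner_eq0.
Qed.

Lemma pihomog_mulr (p g : S) e d : g \is e.-homog ->
  pihomog mdeg d (p * g) = mfilter (fun a => mdeg a + e == d)%N p * g.
Proof.
move=> hg; rewrite {1}[p]mpolyE mulr_suml raddf_sum /= /mfilter mulr_suml [RHS]big_mkcond /=.
apply: eq_bigr => a _; have ha : (p@_a *: 'X_[a]) * g \is (mdeg a + e).-homog.
  by apply: dhomogM => //; apply: dhomogZ; rewrite dhomogX.
case: eqP => [<-|/eqP ne]; first by rewrite pihomog_dE.
by rewrite (pihomog_ne0 ne).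
Qed.

(** Generators need not be monomials here. If no minimal monomial had degree [d], each monomial of a
    generator [f] of degree [d] would be a proper multiple of a minimal one, and [f] would be
    redundant by [low]. *)
Lemma minimal_generator_degreeP L d : monomial_ideal L ->
  minimal_generator_degree L d <-> exists2 u, minimal_exponent L u & mdeg u = d.
Proof.
move=> hL; have [idL LP] := hL; split=> [[X [homX mX [f Xf fd]]]|[u hu <-]]; last first.
  exists (minimal_monomials L); split.
  - by move=> _ [v _ ->]; exists (mdeg v); rewrite dhomogX.
  - exact: minimal_monomials_generate.
  by exists 'X_[u]; [exists u|rewrite dhomogX].
apply: NNPP => hn; case: (generated_without mX _ Xf).
set Y := (fun _ => _); have [gX _] := mX.
(* Take the component of degree [mdeg v] of an expression of ['X_[v]]: multiples of [f] start in
   degree [d] and contribute nothing. *)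
have low v : L 'X_[v] -> (mdeg v < d)%N -> ideal_gen Y 'X_[v].
  move=> /gX[s [hs sE]] vd.
  have -> : 'X_[v] = pihomog mdeg (mdeg v) ('X_[v] : S) by rewrite pihomog_dE // dhomogX.
  rewrite sE raddf_sum big_seq_cond /=; apply: ideal_sum; first exact: ideal_gen_ideal.
  move=> [p g] /= /andP[/hs /= Xg _]; case: (classic (g = f)) => [->|ne].
    rewrite (pihomog_mulr _ _ fd) mfilter_eq0 ?mul0r; first by case: (ideal_gen_ideal Y).
    move=> a _; apply/eqP => e; move: vd; rewrite -e ltnNge leq_addl //.
  have [e ge] := homX _ Xg; rewrite (pihomog_mulr _ _ ge).
  by case: (ideal_gen_ideal Y) => _ _; apply; apply: ideal_gen_in.
have Lf : L f by apply/gX/ideal_gen_in.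
rewrite [f]mpolyE big_seq_cond; apply: ideal_sum; first exact: ideal_gen_ideal.
move=> a; rewrite andbT => af; have ad := dhomog_mf fd af.
have [u hu ua] := minimal_exponent_below (proj1 (LP f) Lf a af).
rewrite -mul_mpolyC; case: (ideal_gen_ideal Y) => _ _; apply.
apply: (monomial_ideal_up (ideal_gen_ideal _) ua); apply: low; first by case: hu.
rewrite -ad ltnNge; apply/negP => /(mdeg_le_eq ua) e; apply: hn.
by exists u => //; rewrite e.
Qed.

Lemma omegaP L : monomial_ideal L -> (exists a, L 'X_[a]) ->
  (exists2 u, minimal_exponent L u & mdeg u = omega L) /\
  forall u, minimal_exponent L u -> (mdeg u <= omega L)%N.
Proof.
move=> hL [a0 La0].
suff /(epsilon_spec (inhabits 0%N)) : exists d, minimal_generator_degree L d /\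
    forall d', minimal_generator_degree L d' -> (d' <= d)%N.
  case=> /(minimal_generator_degreeP _ hL) h1 h2; split=> // u hu.
  by apply: h2; apply/(minimal_generator_degreeP _ hL); exists u.
have [s sL sdom] := dickson (fun a => L 'X_[a]).
pose N := (\max_(a <- s) mdeg a)%N.
have bound d : minimal_generator_degree L d -> (d <= N)%N.
  move=> /(minimal_generator_degreeP _ hL)[u [Lu umin] <-].
  have [c cs cu] := sdom _ Lu; rewrite -(umin _ (sL _ cs) cu).
  exact: leq_bigmax_seq.
have [u0 hu0 _] := minimal_exponent_below La0.
(* The largest degree [d] is found by minimizing [N - d]; Dickson's lemma supplies the bound [N]. *)
have [|_ [d hd ->] dmin] := @ex_min_nat (fun k =>
    exists2 d, minimal_generator_degree L d & k = (N - d)%N).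
  by eexists; exists (mdeg u0) => //; apply/(minimal_generator_degreeP _ hL); exists u0.
exists d; split=> // d' hd'; have := dmin _ (ex_intro2 _ _ d' hd' erefl).
have := bound _ hd; have := bound _ hd'; lia.
Qed.

Lemma standard_graded_module :
  graded_module (fun=> 1%N) (fun p b : S => idfun p * b) (fun d f => f \is d.-homog)
    (pihomog mdeg).
Proof.
split=> //=.
- by move=> p q x; rewrite mulrDl.
- by move=> p x y; rewrite mulrDr.
- by move=> p q x; rewrite mulrA.
- by move=> x; rewrite mul1r.
- move=> d c a x hx; apply: dhomogM => //; apply: dhomogZ.
  by rewrite dhomogX weighted_degree1.
- by move=> d x y; rewrite raddfD.
- by move=> d x /pihomog_dE.
by move=> d e x hx de; rewrite (pihomog_ne0 de).
Qed.

Lemma monomial_ideal_generators L : monomial_ideal L ->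
  exists r (s : 'I_r -> nat) x,
    homog_generators (fun p b : S => idfun p * b) (fun d f => f \is d.-homog) s x L.
Proof.
move=> [idL hL]; have [s sL sdom] := dickson (fun a => L 'X_[a]).
exists (size s), (fun j => mdeg (tnth (in_tuple s) j)), (fun j => 'X_[tnth (in_tuple s) j]).
split=> [j|f]; first by rewrite dhomogX.
split=> [/hL Lf|[v ->]]; last first.
  by apply: ideal_sum => // j _; case: idL => _ _; apply; apply: sL; rewrite mem_tnth.
pose x (j : 'I_(size s)) : S := 'X_[tnth (in_tuple s) j].
pose P f := exists v, f = lincomb (fun p b : S => idfun p * b) x v.
have gS := standard_graded_module.
have idP : is_ideal P.
  split=> [|g h [v ->] [u ->]|g h [v ->]].
  - by exists 0; rewrite (lincomb0 gS).
  - by exists (v + u); rewrite (lincombD gS).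
  by exists (g *: v); rewrite (lincombZ gS).
suff : P f by [].
rewrite [f]mpolyE big_seq_cond; apply: ideal_sum => // a; rewrite andbT => /Lf/sdom[c cs ca].
rewrite -mul_mpolyC; case: (idP) => _ _; apply; apply: (monomial_ideal_up idP ca).
have /tnthP[j ->] : c \in in_tuple s by [].
by exists (delta_mx 0 j); rewrite (lincomb_delta gS).
Qed.

Definition is_reg L (r : int) :=
  is_regularity (fun=> 1%N) id (fun d (f : S) => f \is d.-homog) L id r.

Lemma regP L : monomial_ideal L -> (exists a, L 'X_[a]) -> is_reg L (reg L).
Proof.
move=> hL [a La]; apply: (regularityP (phi := idfun) _ _ standard_graded_module).
- by move=> x y z; apply: addIn.
- by move=> c; rewrite weighted_degree1 => /eqP; rewrite mdeg_eq0 => /eqP.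
- exact: monomial_ideal_generators.
exists 'X_[a] => //; apply/eqP => /(congr1 (mcoeff a)); rewrite mcoeffX eqxx mcoeff0.
by move/eqP; rewrite oner_eq0.
Qed.

Lemma resolution_aug_in L F l : standard_resolution L F -> L (aug F l).
Proof.
move=> hF; apply/(aug_image hF); exists (delta_mx 0 l).
have := lincomb_delta standard_graded_module (aug F) l; rewrite /lincomb /augmentation => <-.
by [].
Qed.

(** Writing ['X_[u]] through the augmentation, some monomial of a generator [aug F l] divides it,
    and equals it by minimality. Minimality is taken in the larger ideal [L'] with a view to
    $I^k\subset I^{(k)}$. *)
Lemma resolution_minimal_exponent L L' F u : standard_resolution L F ->
  (forall f, L f -> L' f) -> monomial_ideal L' -> minimal_exponent L' u -> L 'X_[u] ->
  exists l, shift F 0 l = mdeg u.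
Proof.
move=> hF LL' [_ hL'] [_ umin] /(aug_image hF)[v /(congr1 (mcoeff u))].
rewrite mcoeffX eqxx => uE.
have : u \in msupp (augmentation id v).
  by rewrite mcoeff_msupp -uE oner_eq0.
move=> /msupp_sum_le/flattenP[_ /mapP[l _ ->]] /msuppM_le/allpairsP[[c d] /= [_ hd ucd]].
exists l; have hl := dhomog_mf (aug_homogeneous hF l) hd.
rewrite -hl; congr mdeg; apply: umin; last by rewrite ucd lem_addl.
exact: (proj1 (hL' _) (LL' _ (resolution_aug_in l hF))).
Qed.

Lemma is_reg_ge L L' u r : is_reg L r -> (forall f, L f -> L' f) -> monomial_ideal L' ->
  minimal_exponent L' u -> L 'X_[u] -> (mdeg u)%:Z <= r.
Proof.
case=> F [hF _ le] LL' hL' hu Lu.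
have [l <-] := resolution_minimal_exponent hF LL' hL' hu Lu.
by have := le 0%N l; rewrite subr0.
Qed.

End MonomialIdeals.

(** * Symbolic powers of ideals of minimal intersection type *)

Section PartialDegree.
Variables (K : fieldType) (n : nat).
Local Notation S := {mpoly K[n]}.
Implicit Types (V : {set 'I_n}) (f g s : S) (a c : 'X_{1..n}).

Definition vdeg V a := (\sum_(i in V) a i)%N.

Definition order_ge V N f : Prop := forall a, a \in msupp f -> (N <= vdeg V a)%N.

Lemma vdegD V a c : vdeg V (a + c)%MM = (vdeg V a + vdeg V c)%N.
Proof. by rewrite /vdeg -big_split; apply: eq_bigr => i _; rewrite mnmDE. Qed.

Lemma vdeg0 V : vdeg V 0%MM = 0%N.
Proof. by rewrite /vdeg big1 // => i _; rewrite mnm0E. Qed.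

Lemma vdegMn V a k : vdeg V (a *+ k)%MM = (vdeg V a * k)%N.
Proof. by rewrite /vdeg big_distrl; apply: eq_bigr => i _; rewrite mulmnE. Qed.

Lemma vdegU V i : vdeg V U_(i)%MM = (i \in V).
Proof.
rewrite /vdeg; case: (boolP (i \in V)) => iV.
  rewrite (bigD1 i) //= mnm1E eqxx big1 // => j /andP[_ /negPf].
  by rewrite mnm1E eq_sym => ->.
rewrite big1 // => j jV; rewrite mnm1E; case: eqP => // ij.
by rewrite ij jV in iV.
Qed.

Lemma order_ge_ideal V N : is_ideal (order_ge V N).
Proof.
split=> [a|f g hf hg a|f g hg a]; first by rewrite msupp0.
  by move=> /msuppD_le; rewrite mem_cat => /orP[/hf|/hg].
move=> /msuppM_le/allpairsP[[c d] /= [_ /hg h ->]]; rewrite vdegD.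
exact: leq_trans h (leq_addl _ _).
Qed.

Lemma order_geX V N a : order_ge V N 'X_[a] <-> (N <= vdeg V a)%N.
Proof.
split=> [|h c]; last by rewrite msuppX inE => /eqP->.
by apply; rewrite msuppX mem_head.
Qed.

Lemma order_geM V N M f g : order_ge V N f -> order_ge V M g -> order_ge V (N + M) (f * g).
Proof.
move=> hf hg a /msuppM_le/allpairsP[[c d] /= [/hf hc /hg hd ->]].
by rewrite vdegD leq_add.
Qed.

Lemma ideal_pow_order V N (I : S -> Prop) k f :
  (forall g, I g -> order_ge V N g) -> ideal_pow I k f -> order_ge V (k * N) f.
Proof.
move=> hI; apply: ideal_gen_sub; first exact: order_ge_ideal.
move=> _ [g [hg ->]]; elim: k g hg => [|k IH] g hg; first by move=> a.
rewrite big_ord_recl mulSn; apply: order_geM; first exact/hI/hg.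
by apply: IH => i; apply: hg.
Qed.

Lemma vdeg_gt0 V a : (0 < vdeg V a)%N -> exists2 i, i \in V & a i != 0%N.
Proof.
move=> h; apply: NNPP => hn; move: h; rewrite /vdeg big1 // => i iV.
by apply/eqP/negPn/negP => ai; apply: hn; exists i.
Qed.

Lemma monomial_prime_order V f : monomial_prime V f <-> order_ge V 1 f.
Proof.
split=> [|hf].
  apply: ideal_gen_sub; first exact: order_ge_ideal.
  by move=> _ [i iV ->]; apply/order_geX; rewrite vdegU iV.
rewrite [f]mpolyE big_seq_cond; apply: ideal_sum; first exact: ideal_gen_ideal.
move=> a; rewrite andbT => /hf/vdeg_gt0[i iV ai]; rewrite -mul_mpolyC.
rewrite -(@submK _ U_(i) a) ?lep1mP // mpolyXD mulrA.
by case: (ideal_gen_ideal (fun f : S => exists2 i, i \in V & f = 'X_i)) => _ _;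
  apply; apply: ideal_gen_in; exists i.
Qed.

(** Conversely, a monomial of $V$-degree at least $e$ is a multiple of $e$ variables from $V$, split
    off one at a time. *)
Lemma monomial_prime_pow_order V e f :
  ideal_pow (monomial_prime V) e f <-> order_ge V e f.
Proof.
split=> [/(@ideal_pow_order V 1)|hf].
  by rewrite muln1; apply=> g /monomial_prime_order.
rewrite [f]mpolyE big_seq_cond; apply: ideal_sum; first exact: ideal_gen_ideal.
move=> a; rewrite andbT => /hf; rewrite -mul_mpolyC => ha.
case: (ideal_gen_ideal (fun f => exists g : 'I_e -> S,
  (forall i, monomial_prime V (g i)) /\ f = \prod_i g i)) => _ _; apply.
elim: e a ha {hf} => [|e IH] a ha; first exact: ideal_pow0.
have /vdeg_gt0[i iV ai] := leq_ltn_trans (leq0n e) ha.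
have ia : (U_(i) <= a)%MM by rewrite lep1mP.
move: ha; rewrite -(submK ia) addmC vdegD vdegU iV add1n ltnS mpolyXD => /IH.
by apply: ideal_powS; apply: ideal_gen_in; exists i.
Qed.

(* x_i |-> x_i t for i in V turns the V-order into the t-adic order, which is *)
(* additive because S[t] is a domain.                                         *)
Definition grade_var V (i : 'I_n) : {poly S} := if i \in V then ('X_i)%:P * 'X else ('X_i)%:P.

Definition grade_map V : S -> {poly S} := mmap (polyC \o mpolyC n (R := K)) (grade_var V).

Lemma grade_mapX V a : grade_map V 'X_[a] = ('X_[a])%:P * 'X^(vdeg V a).
Proof.
rewrite /grade_map mmapX /mmap1 mpolyXE_id rmorph_prod /= /vdeg -prodrXr /=.
rewrite [X in _ = _ * X]big_mkcond /= -big_split; apply: eq_bigr => i _ /=.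
by rewrite /grade_var; case: ifP => _; rewrite ?exprMn rmorphXn /= ?mulr1.
Qed.

Lemma coef_grade_map V f k : (grade_map V f)`_k = mfilter (fun a => vdeg V a == k) f.
Proof.
rewrite {1}[f]mpolyE /grade_map raddf_sum /= coef_sum /mfilter [RHS]big_mkcond /=.
apply: eq_bigr => a _; rewrite mmapZ /= -/(grade_map V 'X_[a]) grade_mapX mulrA -polyCM.
rewrite coefCM coefXn mul_mpolyC eq_sym; case: eqP => _; by rewrite ?mulr1 ?mulr0.
Qed.

Lemma order_ge_grade V N f :
  order_ge V N f <-> forall k, (k < N)%N -> (grade_map V f)`_k = 0.
Proof.
split=> [h k kN|h a af].
  rewrite coef_grade_map mfilter_eq0 // => a /h le.
  by apply: contraTneq kN => <-; rewrite -leqNgt.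
rewrite leqNgt; apply/negP => /h; rewrite coef_grade_map => /(congr1 (mcoeff a)).
by rewrite mcoeff_mfilter eqxx mcoeff0 => /eqP; rewrite mcoeff_eq0 af.
Qed.

(** This says that $P_V^N$ is $P_V$-primary. The image of [s] under [grade_map] has nonzero constant
    coefficient $s_0$; if the coefficients of [f] below $k$ vanish, coefficient $k$ of the product
    is $s_0f_k$. *)
Lemma order_ge_cancel V N s f : ~ order_ge V 1 s -> order_ge V N (s * f) -> order_ge V N f.
Proof.
move=> hs /order_ge_grade h.
have s0 : (grade_map V s)`_0 != 0.
  by apply/eqP => s0; apply: hs; apply/order_ge_grade => -[].
apply/order_ge_grade; elim/ltn_ind=> k IH kN.
have gM : grade_map V (s * f) = grade_map V s * grade_map V f by exact: rmorphM.
have := h k kN; rewrite gM coefM big_ord_recl /= subn0 big1 => [|i _].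
  by move/eqP; rewrite addr0 mulf_eq0 (negPf s0) => /eqP.
have ik : (k - bump 0 i < k)%N by rewrite /bump /=; have := ltn_ord i; lia.
by apply/eqP; rewrite mulf_eq0; apply/orP; right; apply/eqP/IH => //; apply: ltn_trans kN.
Qed.

Lemma order_ge_mulX V N f c :
  order_ge V N (f * 'X_[c]) <-> forall a, a \in msupp f -> (N <= vdeg V a + vdeg V c)%N.
Proof.
split=> h a af; last first.
  move: af; rewrite (perm_mem (msuppMX _ _)) => /mapP[d /h le ->].
  by rewrite addmC vdegD.
rewrite -vdegD; apply: h; rewrite (perm_mem (msuppMX _ _)) addmC.
exact: map_f.
Qed.

Lemma mnm_part V N a : (N <= vdeg V a)%N -> exists2 c, (c <= a)%MM & vdeg V c = N.
Proof.
elim: N => [|N IH] lt; first by exists 0%MM; [apply/mnm_lepP => i; rewrite mnm0E|rewrite vdeg0].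
have [c ca cN] := IH (ltnW lt).
have : (0 < vdeg V (a - c)%MM)%N.
  by move: lt; rewrite -{1}(submK ca) vdegD cN -{1}[N]add0n ltn_add2r.
move=> /vdeg_gt0[i iV ai]; exists (U_(i) + c)%MM; last by rewrite vdegD vdegU iV cN.
apply/mnm_lepP => j; rewrite mnmDE mnm1E; case: eqP => [<-|_]; last exact: (elimT mnm_lepP ca).
by move: ai; rewrite mnmBE subn_eq0 -ltnNge.
Qed.

End PartialDegree.

(** * Symbolic powers as intersections of powers of monomial primes *)

Section SymbolicPowers.
Variables (K : fieldType) (n : nat).
Local Notation S := {mpoly K[n]}.
Variables (I : S -> Prop) (m : nat) (V : 'I_m -> {set 'I_n}) (e : 'I_m -> nat).
Hypothesis V_e_pos : forall i, V i != set0 /\ (0 < e i)%N.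
Hypothesis V_incomparable : forall i j, i != j -> exists2 v, v \in V i & v \notin V j.
Hypothesis IP : forall f, I f <-> forall i, order_ge (V i) (e i) f.

(** A monomial outside $P_i$ lying in $P_j^{e_j}$ for all $j\ne i$. The exponent $\sum_je_j$ is one
    value large enough for every $j$, as $V_j$ has a variable not in $V_i$. *)
Definition outside i : 'X_{1..n} := [multinom if v \in V i then 0%N else \sum_j e j | v < n].

Lemma vdeg_outside i : vdeg (V i) (outside i) = 0%N.
Proof. by rewrite /vdeg big1 // => v vi; rewrite mnmE vi. Qed.

Lemma vdeg_outside_ge i j : i != j -> (e i <= vdeg (V i) (outside j))%N.
Proof.
move=> /V_incomparable[v vi vj]; rewrite /vdeg (bigD1 v) //= mnmE (negPf vj).
by rewrite (bigD1 i) //= -addnA leq_addr.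
Qed.

Lemma monomial_prime_associated i : associated_prime I (monomial_prime (V i)).
Proof.
split.
  split; first exact: ideal_gen_ideal.
    move=> /monomial_prime_order/(_ 0%MM); rewrite vdeg0 mcoeff_msupp mcoeff1 eqxx oner_eq0.
    by move=> /(_ isT).
  move=> f g /monomial_prime_order fg.
  case: (classic (order_ge (V i) 1 f)) => hf; [left|right]; apply/monomial_prime_order => //.
  exact: order_ge_cancel hf fg.
have [/set0Pn[v vi] ei] := V_e_pos i.
(* This monomial satisfies all conditions except the $i$-th, where its degree is $e_i-1$; so $P_i$
   is its annihilator modulo $I$. *)
exists 'X_[outside i + U_(v) *+ (e i).-1] => g; rewrite IP; split.
  move=> /monomial_prime_order hg j; apply/order_ge_mulX => a /hg ha.
  rewrite vdegD; case: (eqVneq j i) => [->|ji].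
    by rewrite vdeg_outside vdegMn vdegU vi mul1n -(prednK ei) -addn1 addnC leq_add2r.
  by rewrite addnCA; apply: leq_trans (vdeg_outside_ge ji) (leq_addr _ _).
move=> /(_ i)/order_ge_mulX h; apply/monomial_prime_order => a /h.
by rewrite vdegD vdeg_outside vdegMn vdegU vi mul1n -{1}(prednK ei) -add1n leq_add2r.
Qed.

(** Cut [a] into $k$ factors of $V_i$-degree at least $e_i$; each of them times [outside i] lies in
    $I$. *)
Lemma outside_pow i k a : (k * e i <= vdeg (V i) a)%N ->
  ideal_pow I k 'X_[outside i *+ k + a].
Proof.
elim: k a => [|k IH] a ha; first exact: ideal_pow0.
have [|c ca ce] := @mnm_part _ (V i) (e i) a; first by apply: leq_trans ha; apply: leq_addr.
have -> : (outside i *+ k.+1 + a)%MM = ((outside i + c) + (outside i *+ k + (a - c)))%MM.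
  apply/mnmP => v; rewrite mulmS !mnmDE mnmBE.
  by have := elimT mnm_lepP ca v; lia.
rewrite mpolyXD; apply: ideal_powS; last first.
  by apply: IH; move: ha; rewrite -{1}(submK ca) vdegD ce mulSn addnC leq_add2r.
apply/IP => j; apply/order_geX; rewrite vdegD; case: (eqVneq j i) => [->|ji].
  by rewrite ce leq_addl.
by apply: leq_trans (vdeg_outside_ge ji) (leq_addr _ _).
Qed.

(** One direction localizes at the associated prime $P_i$ and cancels. For the other, let $P$ be the
    annihilator of $w$ modulo $I$: some $P_i^{e_i}$ does not contain $w$, and the $k$th power of
    [outside i] is a denominator outside $P$ carrying $f$ into $I^k$. The full set $\mathrm{Ass}(I)$
    is never computed. *)
Lemma symbolic_powerP k f :
  symbolic_power I k f <-> forall i, order_ge (V i) (k * e i) f.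
Proof.
split=> [h i|h P [[[P0 PD PM] P1 primeP] [w Pw]]].
  have [s nPs /ideal_pow_order hs] := h _ (monomial_prime_associated i).
  apply: (@order_ge_cancel _ _ _ _ s); first by move=> /monomial_prime_order.
  by apply: hs => g /IP.
have [i wi] : exists i, ~ order_ge (V i) (e i) w.
  apply: NNPP => hn; apply: P1; apply/Pw; rewrite mul1r; apply/IP => i.
  by apply: NNPP => hi; apply: hn; exists i.
exists 'X_[outside i *+ k].
  (* If this power were in $P$, its product with $w$ would lie in $P_i^{e_i}$, and cancelling it
     would put $w$ there. *)
  move=> /Pw/IP/(_ i) hw; apply: wi; apply: order_ge_cancel hw => /order_geX.
  by rewrite vdegMn vdeg_outside.
rewrite [f]mpolyE mulr_sumr big_seq_cond; apply: ideal_sum; first exact: ideal_gen_ideal.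
move=> a; rewrite andbT => /(h i) ha; rewrite -scalerAr -mpolyXD -mul_mpolyC.
case: (ideal_gen_ideal (fun f => exists g : 'I_k -> S,
  (forall i, I (g i)) /\ f = \prod_i g i)) => _ _; apply; exact: outside_pow.
Qed.

Lemma symbolic_powerX k a :
  symbolic_power I k 'X_[a] <-> forall i, (k * e i <= vdeg (V i) a)%N.
Proof.
rewrite symbolic_powerP; split=> h i; last exact/order_geX.
by have /order_geX := h i.
Qed.

Lemma symbolic_power_monomial k : monomial_ideal (symbolic_power I k).
Proof.
split=> [|f].
  split=> [|f g|f g]; rewrite !symbolic_powerP.
  - by move=> i; case: (@order_ge_ideal K n (V i) (k * e i)).
  - by move=> hf hg i; case: (@order_ge_ideal K n (V i) (k * e i)) => _ h _; apply: h.
  by move=> hg i; case: (@order_ge_ideal K n (V i) (k * e i)) => _ _; apply.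
rewrite symbolic_powerP; split=> [h a af|h i a /h]; first by apply/symbolic_powerX => i; apply: h.
by move=> /symbolic_powerX.
Qed.

Lemma symbolic_power1 f : symbolic_power I 1 f <-> I f.
Proof. by rewrite symbolic_powerP IP; split=> h i; have := h i; rewrite mul1n. Qed.

Lemma ideal_pow_symbolic k f : ideal_pow I k f -> symbolic_power I k f.
Proof. by move=> hf; apply/symbolic_powerP => i; apply: ideal_pow_order hf => g /IP. Qed.

Lemma intersection_monomial : monomial_ideal I.
Proof.
have [[I0 ID IM] hI] := symbolic_power_monomial 1.
split=> [|f]; last first.
  by rewrite -symbolic_power1 hI; split=> h a /h/symbolic_power1.
split=> [|f g|f g]; rewrite -!symbolic_power1 //; [exact: ID|exact: IM].
Qed.

Lemma intersection_neq0 : exists a, I 'X_[a].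
Proof.
exists [multinom \sum_j e j | v < n]; apply/IP => i; apply/order_geX.
have [/set0Pn[v vi] _] := V_e_pos i.
by rewrite /vdeg (bigD1 v) //= mnmE (bigD1 i) //= -addnA leq_addr.
Qed.

(** Suppose [a] divides $u^k$ with a smaller exponent at $v$. Minimality of $u$ gives an $i$ with
    $v\in V_i$ for which $u$ has $V_i$-degree exactly $e_i$, so [a] has $V_i$-degree below
    $ke_i$. *)
Lemma minimal_exponent_symbolic u k : (0 < k)%N -> minimal_exponent I u ->
  minimal_exponent (symbolic_power I k) (u *+ k)%MM.
Proof.
move=> k0 [Iu umin]; have Iu' i : (e i <= vdeg (V i) u)%N by move/IP: Iu => /(_ i)/order_geX.
split=> [|a /symbolic_powerX ha au].
  by apply/symbolic_powerX => i; rewrite vdegMn mulnC leq_mul2r Iu' orbT.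
apply/mnmP => v; apply/eqP; rewrite eqn_leq (elimT mnm_lepP au _) /= leqNgt.
apply/negP => lt; have uv : u v != 0%N by apply: contraTneq lt; rewrite mulmnE => ->.
have vu : (U_(v) <= u)%MM by rewrite lep1mP.
have [i hi] : exists i, (vdeg (V i) (u - U_(v))%MM < e i)%N.
  apply: NNPP => hn; have : (u - U_(v))%MM = u.
    apply: umin; last exact: lem_subr.
    apply/IP => i; apply/order_geX; rewrite leqNgt; apply/negP => h; apply: hn; by exists i.
  by move=> /mnmP/(_ v); rewrite mnmBE mnm1E eqxx; lia.
have := Iu' i; have : vdeg (V i) u = (vdeg (V i) (u - U_(v))%MM + (v \in V i))%N.
  by rewrite -{1}(submK vu) vdegD vdegU.
case: (boolP (v \in V i)) => [vi e1 e2|_]; last by lia.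
have ue : vdeg (V i) u = e i by lia.
have := ha i; rewrite -ue mulnC -vdegMn leqNgt => /negP; apply.
rewrite /vdeg (bigD1 v) //= [X in (_ < X)%N](bigD1 v) //= -addSn leq_add //.
by apply: leq_sum => j _; apply: (elimT mnm_lepP au _).
Qed.

End SymbolicPowers.

(** * The symbolic Rees algebra *)

Section SplitVariables.
Variables (K : fieldType) (n r : nat).
Local Notation S := {mpoly K[n]}.
Local Notation T := {mpoly K[n + r]}.

Definition mnm_cat (a : 'X_{1..n}) (c : 'X_{1..r}) : 'X_{1..n + r} :=
  [multinom match split i with inl i => a i | inr j => c j end | i < n + r].

Definition mnm_left (a : 'X_{1..n + r}) : 'X_{1..n} := [multinom a (lshift r i) | i < n].
Definition mnm_right (a : 'X_{1..n + r}) : 'X_{1..r} := [multinom a (rshift n i) | i < r].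

Lemma mnm_cat_lshift a c i : mnm_cat a c (lshift r i) = a i.
Proof. by rewrite mnmE (unsplitK (inl i)). Qed.

Lemma mnm_cat_rshift a c j : mnm_cat a c (rshift n j) = c j.
Proof. by rewrite mnmE (unsplitK (inr j)). Qed.

Lemma eq_mnm_cat a b c : (a == mnm_cat b c) = (mnm_left a == b) && (mnm_right a == c).
Proof.
apply/eqP/andP => [->|[/eqP<- /eqP<-]].
  split; apply/eqP/mnmP => i; rewrite mnmE; first exact: mnm_cat_lshift.
  exact: mnm_cat_rshift.
apply/mnmP => i; rewrite -(splitK i); case: (split i) => j /=.
  by rewrite mnm_cat_lshift mnmE.
by rewrite mnm_cat_rshift mnmE.
Qed.

Lemma mnm_catE (b : 'X_{1..n + r}) : b = mnm_cat (mnm_left b) (mnm_right b).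
Proof. by apply/eqP; rewrite eq_mnm_cat !eqxx. Qed.

Definition x_embed : S -> T := mmap (@mpolyC (n + r) K) (fun i => 'X_(lshift r i)).

HB.instance Definition _ := GRing.RMorphism.copy x_embed
  (mmap (@mpolyC (n + r) K) (fun i => 'X_(lshift r i))).

Definition split_var (i : 'I_(n + r)) : {mpoly S[r]} :=
  match split i with inl i => ('X_i)%:MP | inr j => 'X_j end.

(** The identification $T=S[y_1,\dots,y_r]$; its coefficients in $S$ serve later as coordinates. *)
Definition split_poly : T -> {mpoly S[r]} := mmap (@mpolyC r S \o @mpolyC n K) split_var.

HB.instance Definition _ := GRing.RMorphism.copy split_poly
  (mmap (@mpolyC r S \o @mpolyC n K) split_var).

Lemma split_polyX a : split_poly 'X_[a] = ('X_[mnm_left a])%:MP * 'X_[mnm_right a].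
Proof.
rewrite /split_poly mmapX /mmap1 big_split_ord /= mpolyXE_id rmorph_prod [in RHS]mpolyXE_id.
congr (_ * _); apply: eq_bigr => i _; rewrite mnmE.
  by rewrite rmorphXn /split_var (unsplitK (inl i)).
by rewrite /split_var (unsplitK (inr i)).
Qed.

Lemma split_polyE p : split_poly p =
  \sum_(a <- msupp p) (p@_a *: 'X_[mnm_left a])%:MP * 'X_[mnm_right a].
Proof.
rewrite {1}/split_poly /mmap; apply: eq_bigr => a _.
rewrite -(mmapX split_var (@mpolyC r S \o @mpolyC n K)) -[mmap _ _ _]/(split_poly 'X_[a]).
by rewrite split_polyX mulrA /= -mpolyCM -[p@_a *: _]mul_mpolyC.
Qed.

Lemma mcoeff_split_poly p a c : ((split_poly p)@_c)@_a = p@_(mnm_cat a c).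
Proof.
rewrite split_polyE {3}[p]mpolyE (raddf_sum (mcoeff c)) (raddf_sum (mcoeff a)).
rewrite (raddf_sum (mcoeff (mnm_cat a c))) /=; apply: eq_bigr => b _.
rewrite mcoeffCM mcoeffX mcoeffZ mcoeffX eq_mnm_cat andbC.
by case: eqP => _; rewrite ?mulr1 ?mulr0 ?mcoeff0 // mcoeffZ mcoeffX.
Qed.

Lemma split_poly_inj : injective split_poly.
Proof.
move=> p p' e; apply/mpolyP => b.
by rewrite [b]mnm_catE -!mcoeff_split_poly e.
Qed.

Lemma x_embedX a : x_embed 'X_[a] = 'X_[mnm_cat a 0].
Proof.
rewrite /x_embed mmapX /mmap1 [RHS]mpolyXE_id big_split_ord /=.
rewrite [X in _ = _ * X]big1 ?mulr1.
  by apply: eq_bigr => i _; rewrite mnm_cat_lshift.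
by move=> i _; rewrite mnm_cat_rshift mnm0E expr0.
Qed.

Lemma x_embedE p : x_embed p = \sum_(a <- msupp p) p@_a *: 'X_[mnm_cat a 0].
Proof.
rewrite {1}[p]mpolyE raddf_sum /=; apply: eq_bigr => a _.
by rewrite {1}/x_embed mmapZ -[mmap _ _ _]/(x_embed 'X_[a]) x_embedX mul_mpolyC.
Qed.

Lemma msupp_x_embed p b : b \in msupp (x_embed p) -> exists2 a, a \in msupp p & b = mnm_cat a 0.
Proof.
rewrite x_embedE => /msupp_sum_le/flattenP[_ /mapP[a ap ->] /msuppZ_le].
by rewrite msuppX inE => /eqP->; exists a => //; move: ap; rewrite mem_filter.
Qed.

Lemma split_poly_x_embed p : split_poly (x_embed p) = p%:MP.
Proof.
have l0 a : mnm_left (mnm_cat a 0%MM) = a.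
  by apply/mnmP => i; rewrite mnmE mnm_cat_lshift.
have r0 a : mnm_right (mnm_cat a 0%MM) = 0%MM.
  by apply/mnmP => i; rewrite mnmE mnm_cat_rshift mnm0E.
rewrite x_embedE {3}[p]mpolyE !raddf_sum /=; apply: eq_bigr => a _.
by rewrite {1}/split_poly mmapZ -[mmap _ _ _]/(split_poly 'X_[mnm_cat a 0]) split_polyX l0 r0
  mpolyX0 mulr1 /= -mpolyCM -[p@_a *: _]mul_mpolyC.
Qed.

Lemma split_polyY c : split_poly 'X_[mnm_cat 0 c] = 'X_[c].
Proof.
rewrite split_polyX; have -> : mnm_left (mnm_cat 0%MM c) = 0%MM.
  by apply/mnmP => i; rewrite mnmE mnm_cat_lshift.
have -> : mnm_right (mnm_cat 0%MM c) = c by apply/mnmP => i; rewrite mnmE mnm_cat_rshift.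
by rewrite mpolyX0 mpolyC1 mul1r.
Qed.

End SplitVariables.

(** * The symbolic Rees algebra as a bigraded module over $T$ *)

Section SymbolicRees.
Variables (K : fieldType) (n : nat) (I : {mpoly K[n]} -> Prop).
Local Notation S := {mpoly K[n]}.
Variables (r : nat) (u : 'I_r -> 'X_{1..n}) (q : 'I_r -> nat).
Local Notation T := {mpoly K[n + r]}.
Local Notation rees_map := (rees_map (K := K) u q).
Local Notation bideg := (rees_bideg u q).
Local Notation wdeg := (weighted_degree bideg).

Hypothesis symbolic_ideal : forall k, is_ideal (symbolic_power I k).
Hypothesis q_gt0 : forall j, (0 < q j)%N.

HB.instance Definition _ := GRing.RMorphism.copy rees_map
  (mmap (polyC \o @mpolyC n K) (rees_gen K u q)).

Lemma pair_mulrn (a b c : nat) : ((a, b) : nat * nat) *+ c = (a * c, b * c)%N.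
Proof.
elim: c => [|c IH]; first by rewrite !muln0.
by rewrite mulrS IH !mulnS.
Qed.

Lemma weighted_degree_cat a c :
  wdeg (mnm_cat a c) = (mdeg a + \sum_s c s * mdeg (u s), \sum_s c s * q s)%N.
Proof.
have pair_sum (J : finType) (f g : J -> nat) :
    \sum_j ((f j, g j) : nat * nat) = (\sum_j f j, \sum_j g j)%N.
  by elim/big_rec3: _ => // j x y z _ ->.
rewrite /weighted_degree big_split_ord /=.
under eq_bigr => i _ do rewrite mnm_cat_lshift /rees_bideg (unsplitK (inl i)) pair_mulrn mul1n mul0n.
under [X in _ + X]eq_bigr => j _ do
  rewrite mnm_cat_rshift /rees_bideg (unsplitK (inr j)) pair_mulrn mulnC [(q j * _)%N]mulnC.
by rewrite !pair_sum mdegE big1_eq.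
Qed.

(** The first component forces the $x$-exponents to vanish; the second forces the $y$-exponents to
    vanish, because $q_j>0$. *)
Lemma bideg_pos b : wdeg b = 0 -> b = 0%MM.
Proof.
rewrite [b]mnm_catE weighted_degree_cat => -[] /eqP; rewrite addn_eq0 => /andP[/eqP a0 _].
move: a0 => /eqP; rewrite mdeg_eq0 => /eqP -> c0; apply/esym/eqP.
rewrite eq_mnm_cat; apply/andP; split; apply/eqP/mnmP => i; rewrite mnmE !mnm0E //.
apply/esym/eqP.
have : (mnm_right b i * q i <= \sum_s mnm_right b s * q s)%N.
  by rewrite (bigD1 i) //= leq_addr.
rewrite c0 leqn0 muln_eq0 => /orP[//|/eqP qi].
by have := q_gt0 i; rewrite qi.
Qed.

Lemma rees_bihomogM d e (f g : {poly S}) : rees_bihomog d f -> rees_bihomog e g ->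
  rees_bihomog (d + e) (f * g).
Proof.
move=> [a ha ->] [b hb ->]; exists (a * b); first exact: dhomogM.
by rewrite exprD polyCM mulrACA.
Qed.

Lemma rees_bihomog1 : rees_bihomog 0 (1 : {poly S}).
Proof. by exists 1; [exact: dhomog1|rewrite mul1r expr0]. Qed.

Lemma rees_bihomog_gen i : rees_bihomog (bideg i) (rees_gen K u q i).
Proof.
rewrite /rees_bideg /rees_gen; case: (split i) => j.
  by exists 'X_j; [rewrite dhomogX; apply/eqP/mdeg1|rewrite expr0 mulr1].
by exists 'X_[u j]; rewrite ?dhomogX.
Qed.

Lemma rees_map_bihomog a : rees_bihomog (wdeg a) (rees_map 'X_[a]).
Proof.
rewrite -[rees_map _]/(mmap (polyC \o @mpolyC n K) (rees_gen K u q) 'X_[a]) mmapX /mmap1.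
rewrite /weighted_degree; elim/big_rec2: _ => [|i d f _ hf]; first exact: rees_bihomog1.
apply: rees_bihomogM hf; elim: (a i) => [|c IH]; first exact: rees_bihomog1.
by rewrite mulrS exprS; apply: rees_bihomogM => //; apply: rees_bihomog_gen.
Qed.

Lemma rees_mapZ c p : rees_map (c *: p) = (c%:MP)%:P * rees_map p.
Proof. exact: (mmapZ (rees_gen K u q) (polyC \o @mpolyC n K)). Qed.

Definition bihomog_part (d : nat * nat) (f : {poly S}) : {poly S} :=
  (pihomog mdeg d.1 f`_d.2)%:P * 'X^(d.2).

Lemma rees_graded_module :
  graded_module bideg (fun p f => rees_map p * f) (@rees_bihomog K n) bihomog_part.
Proof.
split.
- by move=> p p' f; rewrite raddfD mulrDl.
- by move=> p f g; rewrite mulrDr.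
- by move=> p p' f; rewrite rmorphM mulrA.
- by move=> f; rewrite rmorph1 mul1r.
- move=> d c a f hf; apply: rees_bihomogM hf; rewrite rees_mapZ -[wdeg a]add0r.
  apply: rees_bihomogM (rees_map_bihomog a).
  by exists c%:MP; rewrite ?expr0 ?mulr1 // -alg_mpolyC dhomogZ ?dhomog1.
- by move=> d f g; rewrite /bihomog_part coefD raddfD polyCD mulrDl.
- by move=> d _ [a ha ->]; rewrite /bihomog_part coefCM coefXn eqxx mulr1 pihomog_dE.
move=> d e _ [a ha ->] de; rewrite /bihomog_part coefCM coefXn.
case: eqP => [e2|_]; last by rewrite mulr0 raddf0 polyC0 mul0r.
rewrite mulr1 (pihomog_ne0 _ ha) ?polyC0 ?mul0r //.
by apply: contraNneq de => e1; rewrite [d]surjective_pairing e1 -e2 -surjective_pairing.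
Qed.

Lemma rees_map_x_embed p : rees_map (x_embed r p) = p%:P.
Proof.
rewrite x_embedE raddf_sum [X in _ = polyC X]mpolyE raddf_sum /=; apply: eq_bigr => a _.
rewrite rees_mapZ -mul_mpolyC polyCM; congr (_ * _).
rewrite -[rees_map _]/(mmap (polyC \o @mpolyC n K) (rees_gen K u q) 'X_[mnm_cat a 0]).
rewrite mmapX /mmap1 big_split_ord /= [X in _ * X]big1 ?mulr1.
  rewrite [in RHS]mpolyXE_id rmorph_prod; apply: eq_bigr => i _.
  by rewrite mnm_cat_lshift /rees_gen (unsplitK (inl i)) rmorphXn.
by move=> j _; rewrite mnm_cat_rshift mnm0E expr0.
Qed.

Hypothesis rees_generated : generates_rees I u q setT.

Lemma rees_image f : symbolic_rees I f <-> exists p, f = rees_map p.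
Proof.
rewrite rees_generated; split=> [|[p ->]].
  elim=> {f} [c|_ [i _ ->]|f g _ [p ->] _ [p' ->]|f g _ [p ->] _ [p' ->]].
  - exists c%:MP; rewrite -[RHS]/(mmap (polyC \o @mpolyC n K) (rees_gen K u q) c%:MP).
    by rewrite mmapC.
  - exists 'X_i; rewrite -[RHS]/(mmap (polyC \o @mpolyC n K) (rees_gen K u q) 'X_i).
    by rewrite mmapX mmap1U.
  - by exists (p + p'); rewrite raddfD.
  by exists (p * p'); rewrite rmorphM.
set P := subalgebra_gen _ _.
have P0 : P 0.
  by rewrite (_ : 0 = scalar_rees n (0 : K)); [apply: SubalgScalar|rewrite /scalar_rees mpolyC0 polyC0].
have P1 : P 1.
  by rewrite (_ : 1 = scalar_rees n (1 : K)); [apply: SubalgScalar|rewrite /scalar_rees mpolyC1 polyC1].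
rewrite -[rees_map p]/(\sum_(a <- msupp p) scalar_rees n p@_a * \prod_i rees_gen K u q i ^+ a i).
apply: (big_ind P); [exact: P0|exact: SubalgAdd|move=> a _].
apply: SubalgMul; first exact: SubalgScalar.
apply: (big_ind P); [exact: P1|exact: SubalgMul|move=> i _].
elim: (a i) => [|c IH]; first by rewrite expr0; exact: P1.
rewrite exprS; apply: SubalgMul => //.
by apply: SubalgGen; exists i; rewrite ?in_setT.
Qed.

(** As [rees_map] is onto, $\mathcal{R}_s(I)$ is a cyclic $T$-module generated by 1 in bidegree
    0. *)
Lemma rees_homog_generators : exists m (s : 'I_m -> nat * nat) x,
  homog_generators (fun p f => rees_map p * f) (@rees_bihomog K n) s x (symbolic_rees I).
Proof.
exists 1%N, (fun=> 0), (fun=> 1); split=> [_|f]; first exact: rees_bihomog1.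
rewrite rees_image; split=> [[p ->]|[v ->]].
  by exists p%:M; rewrite /lincomb big_ord1 mxE eqxx mulr1 mulr1n.
by exists (v 0 0); rewrite /lincomb big_ord1 mulr1.
Qed.

Lemma symbolic_rees_homog k f : symbolic_power I k f -> symbolic_rees I (f%:P * 'X^k).
Proof.
move=> hf j; rewrite coefCM coefXn; case: eqP => [->|_]; first by rewrite mulr1.
by rewrite mulr0; case: (symbolic_ideal j).
Qed.

Lemma reg_x_reesP : is_regularity bideg rees_map (@rees_bihomog K n) (symbolic_rees I) fst
  (reg_x_rees I u q).
Proof.
apply: (regularityP _ bideg_pos rees_graded_module rees_homog_generators).
  by move=> [a1 a2] [b1 b2] [c1 c2] [/addIn-> /addIn->].
exists 1; last exact: oner_neq0.
by apply/rees_image; exists 1; rewrite rmorph1.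
Qed.

End SymbolicRees.

(** * The strand of degree k of a resolution of the symbolic Rees algebra *)

Section Strand.
Variables (K : fieldType) (n : nat) (I : {mpoly K[n]} -> Prop).
Local Notation S := {mpoly K[n]}.
Variables (r : nat) (u : 'I_r -> 'X_{1..n}) (q : 'I_r -> nat).
Local Notation T := {mpoly K[n + r]}.
Local Notation rees_map := (rees_map (K := K) u q).
Local Notation bideg := (rees_bideg u q).
Local Notation wdeg := (weighted_degree bideg).
Hypothesis symbolic_ideal : forall k, is_ideal (symbolic_power I k).
Hypothesis q_gt0 : forall j, (0 < q j)%N.
Variable F : free_complex K (n + r) (nat * nat)%type {poly S}.
Hypothesis hF : minimal_free_resolution bideg rees_map (@rees_bihomog K n) (symbolic_rees I) F.
Variable k : nat.

Local Notation augF := (@augmentation K (n + r) (nat * nat)%type {poly S} rees_map F).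
(** The strand: [inT i] is the $t$-degree $k$ part of $F_i$, an $S$-module through [x_embed], and
    [homT i d] is its component of $x$-degree $d$. *)
Local Notation inT i := (@homog_row K (n + r) _ (fun l => (bideg l).2) _ (fun j => (shift F i j).2) k).
Local Notation homT i d := (@homog_row K (n + r) _ bideg _ (shift F i) (d, k)).

Lemma weighted_degree_snd a : weighted_degree (fun l => (bideg l).2) a = (wdeg a).2.
Proof. by rewrite /weighted_degree raddf_sum; apply: eq_bigr => i _; rewrite raddfMn. Qed.

Lemma strand_homog_in i d v : homT i d v -> inT i v.
Proof. by move=> h j a /h e; rewrite weighted_degree_snd; move: e => /(congr1 snd). Qed.

Lemma strand_scale i c d p v : p \is c.-homog -> homT i d v ->
  homT i (c + d)%N (x_embed r p *: v).
Proof.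
move=> hp; apply: homog_row_scale => a /msupp_x_embed[b /(dhomog_mf hp) hb ->].
rewrite weighted_degree_cat hb !big1 ?addn0 //.
all: by move=> s _; rewrite mnm0E mul0n.
Qed.

Lemma strand_diff i v : inT i.+1 v -> inT i (v *m diff F i).
Proof.
apply: homog_row_mulmx => j l a /(diff_homogeneous hF)/(congr1 snd) <-.
by rewrite weighted_degree_snd.
Qed.

Lemma strand_lift i d (v : 'rV_(rank F i)) w : homT i d v -> v = w *m diff F i ->
  exists w', homT i.+1 d w' /\ v = w' *m diff F i.
Proof.
by apply: homog_row_lift => j l a; apply: (diff_homogeneous hF).
Qed.

Lemma aug_homog_part d v : bihomog_part d (augF v) = augF (homog_part bideg (shift F 0) d v).
Proof. exact: (pr_lincomb (rees_graded_module K u q) d v (aug_homogeneous hF)). Qed.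

Definition strand_aug v : S := (augF v)`_k.

Lemma strand_augD v w : strand_aug (v + w) = strand_aug v + strand_aug w.
Proof.
have e : augF (v + w) = augF v + augF w.
  exact: (lincombD (rees_graded_module K u q) (aug F) v w).
by rewrite /strand_aug e coefD.
Qed.

Lemma strand_augZ p v : strand_aug (x_embed r p *: v) = p * strand_aug v.
Proof.
have e : augF (x_embed r p *: v) = rees_map (x_embed r p) * augF v.
  exact: (lincombZ (rees_graded_module K u q) (aug F) (x_embed r p) v).
by rewrite /strand_aug e rees_map_x_embed coefCM.
Qed.

Lemma strand_aug_onto f d : symbolic_power I k f -> f \is d.-homog ->
  exists v, homT 0 d v /\ strand_aug v = f.
Proof.
move=> /(symbolic_rees_homog symbolic_ideal)/(aug_image hF)[v vE] hf.
exists (homog_part bideg (shift F 0) (d, k) v); split; first exact: homog_partP.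
rewrite /strand_aug -aug_homog_part -vE /bihomog_part /=.
by rewrite !coefCM !coefXn eqxx !mulr1 pihomog_dE.
Qed.

Lemma strand_aug_in v : symbolic_power I k (strand_aug v).
Proof.
have : symbolic_rees I (augF v) by apply/(aug_image hF); exists v.
exact.
Qed.

Lemma strand_exact0 d v : homT 0 d v -> strand_aug v = 0 ->
  exists w, homT 1 d w /\ v = w *m diff F 0.
Proof.
move=> hv av; have /(exact_at_0 hF)[w] : augF v = 0.
  by rewrite -(homog_part_id hv) -aug_homog_part /bihomog_part /= -/(strand_aug v) av raddf0
    polyC0 mul0r.
exact: strand_lift.
Qed.

Definition y_exponent (c : {ffun 'I_r -> 'I_k.+1}) : 'X_{1..r} := [multinom c j : nat | j < r].

(** The strand is free over $S$ on the $y^ce_j$ of $t$-degree $k$. Indices of another $t$-degree get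
    the value 0, so that the index type is a plain product; exponents up to $k$ suffice as
    $q_s>0$. *)
Definition strand_basis i (jc : 'I_(rank F i) * {ffun 'I_r -> 'I_k.+1}) : 'rV[T]_(rank F i) :=
  if (\sum_s jc.2 s * q s + (shift F i jc.1).2 == k)%N
  then 'X_[mnm_cat 0 (y_exponent jc.2)] *: delta_mx 0 jc.1 else 0.

Definition strand_coord i (v : 'rV[T]_(rank F i))
    (jc : 'I_(rank F i) * {ffun 'I_r -> 'I_k.+1}) : S :=
  (split_poly (v 0 jc.1))@_(y_exponent jc.2).

Lemma strand_coordD i v w jc :
  strand_coord (i := i) (v + w) jc = strand_coord v jc + strand_coord w jc.
Proof. by rewrite /strand_coord mxE raddfD mcoeffD. Qed.

Lemma strand_coordZ i p v jc :
  strand_coord (i := i) (x_embed r p *: v) jc = p * strand_coord v jc.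
Proof. by rewrite /strand_coord mxE rmorphM /= split_poly_x_embed mcoeffCM. Qed.

Lemma strand_supp i v j c a : inT i v -> a \in msupp ((split_poly (v 0 j))@_c) ->
  (\sum_s c s * q s + (shift F i j).2)%N = k.
Proof.
move=> hv; rewrite mcoeff_msupp mcoeff_split_poly -mcoeff_msupp => /hv <-.
by rewrite weighted_degree_snd weighted_degree_cat.
Qed.

Lemma y_exponent_onto (c : 'X_{1..r}) : (\sum_s c s * q s <= k)%N ->
  exists c', y_exponent c' = c.
Proof.
move=> hc; exists [ffun s => inord (c s)]; apply/mnmP => s; rewrite mnmE ffunE inordK //.
rewrite ltnS; apply: leq_trans hc; rewrite (bigD1 s) //=.
by apply: leq_trans (leq_addr _ _); rewrite leq_pmulr.
Qed.

Lemma strand_coordP i v : inT i v ->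
  v = \sum_jc x_embed r (strand_coord v jc) *: strand_basis (i := i) jc.
Proof.
move=> hv; apply/rowP => j; rewrite summxE -(pair_bigA _ (fun j' c =>
  (x_embed r (strand_coord v (j', c)) *: strand_basis (j', c)) 0 j)) /= (bigD1 j) //=.
rewrite [X in _ = _ + X]big1 => [|j' /negPf jj']; last first.
  rewrite big1 // => c _; rewrite mxE /strand_basis /=.
  by case: ifP => _; rewrite !mxE ?mulr0 // eq_sym jj' andbF !mulr0.
rewrite addr0; apply: split_poly_inj; rewrite [RHS]raddf_sum; apply/mpolyP => b.
rewrite [RHS]raddf_sum /=.
have term c : (split_poly ((x_embed r (strand_coord v (j, c)) *: strand_basis (j, c)) 0 j))@_b =
    if b == y_exponent c then (split_poly (v 0 j))@_b else 0.
  rewrite mxE rmorphM /= split_poly_x_embed mcoeffCM /strand_coord /strand_basis /=.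
  case: ifP => hc.
    rewrite !mxE !eqxx mulr1 split_polyY mcoeffX eq_sym.
    by case: eqP => [->|_]; rewrite ?mulr1 ?mulr0.
  (* Where the basis vector was set to 0, the coefficient of [v] vanishes as well: a monomial in it
     would have $t$-degree different from $k$. *)
  rewrite mxE raddf0 mcoeff0 mulr0; case: eqP => // bE.
  apply/esym/msuppnil0; case E : (msupp _) => [//|a t].
  have /(strand_supp hv) : a \in msupp ((split_poly (v 0 j))@_b) by rewrite E mem_head.
  rewrite bE => e; move: hc; rewrite -{}[X in _ == X]e eq_sym; move/negP; case.
  by apply/eqP; congr (_ + _)%N; apply: eq_bigr => s _; rewrite mnmE.
transitivity (\sum_(c : {ffun 'I_r -> 'I_k.+1})
    if b == y_exponent c then (split_poly (v 0 j))@_b else 0); last first.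
  by apply: eq_bigr => c _; exact/esym/term.
case: (eqVneq ((split_poly (v 0 j))@_b) 0) => [->|nz].
  by rewrite big1 // => c _; case: ifP.
have [a ab] : exists a, a \in msupp ((split_poly (v 0 j))@_b).
  by exists (mlead ((split_poly (v 0 j))@_b)); apply: mlead_supp.
have [|c cb] := @y_exponent_onto b.
  by rewrite -[X in (_ <= X)%N](strand_supp hv ab) leq_addr.
rewrite (bigD1 c) //= -{2}cb eqxx big1 ?addr0 // => c' c'c.
case: eqP => // e; case/eqP: c'c; apply/ffunP => s; apply: val_inj.
by move: e; rewrite -cb => /mnmP/(_ s); rewrite !mnmE => /esym.
Qed.

Lemma strand_basis_in i jc : inT i (strand_basis jc).
Proof.
rewrite /strand_basis; case: ifP => [/eqP hk|_]; last exact: homog_row0.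
move=> j a; rewrite !mxE eqxx /=; case: eqP => [->|_]; last by rewrite mulr0 msupp0.
rewrite mulr1 msuppX inE => /eqP->; rewrite weighted_degree_snd weighted_degree_cat.
rewrite -[RHS]hk; congr (_ + _)%N; by apply: eq_bigr => s _; rewrite mnmE.
Qed.

Lemma rees_d_ge (c : {ffun 'I_r -> 'I_k.+1}) : (\sum_s c s * q s <= k)%N ->
  (\sum_s c s * mdeg (u s) <= rees_d u q k)%N.
Proof. by move=> hc; rewrite /rees_d (bigD1 c) //= leq_maxl. Qed.

Hypothesis F_linear : forall i (j : 'I_(rank F i)), ((shift F i j).1 <= i)%N.

(** The $x$-degree $d$ is the sum of [mdeg a], of the degree of $y^c$, at most $d(I,k)$, and of the
    $x$-shift of $e_j$, at most $i$. *)
Lemma strand_coord_deg i d v jc a : homT i d v -> a \in msupp (strand_coord (i := i) v jc) ->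
  (d <= mdeg a + (i + rees_d u q k))%N.
Proof.
case: jc => j c hv; rewrite /strand_coord mcoeff_msupp mcoeff_split_poly -mcoeff_msupp.
move=> /hv; rewrite weighted_degree_cat /= => -[<- hk].
have := F_linear j; have : (\sum_s y_exponent c s * mdeg (u s) <= rees_d u q k)%N.
  under eq_bigr => s _ do rewrite mnmE; apply: rees_d_ge.
  apply: leq_trans (eq_leq hk).
  by under [X in (_ <= X + _)%N]eq_bigr => s _ do rewrite mnmE; apply: leq_addr.
set x := (\sum_s _)%N; rewrite -![(_ + _)%R]/(_ + _)%N; lia.
Qed.

Lemma strand_shift_le F' i (l : 'I_(rank F' i)) :
  standard_resolution (symbolic_power I k) F' -> (shift F' i l <= i + rees_d u q k)%N.
Proof.
move=> hF'; apply: (@shift_le K n _ F' hF' _ (x_embed r) (rank F) (diff F)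
  (fun i => inT i) (fun i d => homT i d) strand_aug _ _ _ _ _ _ _ _ _ _ _ _ _
  (fun i => ('I_(rank F i) * {ffun 'I_r -> 'I_k.+1})%type)
  (fun i => @strand_basis i) (fun i => @strand_coord i)).
- exact: strand_homog_in.
- by move=> *; apply: homog_row0.
- by move=> *; apply: homog_rowD.
- exact: strand_scale.
- exact: strand_diff.
- exact: exact_mulmx0 (exact_at_S hF).
- by move=> i' d v hv /(exact_at_S hF)[w /(strand_lift hv)].
- exact: strand_augD.
- exact: strand_augZ.
- exact: strand_aug_onto.
- by move=> v _; apply: strand_aug_in.
- move=> v _; rewrite /strand_aug (_ : augF _ = 0) ?coef0 //.
  by apply/(exact_at_0 hF); exists v.
- exact: strand_exact0.
- exact: strand_coordD.
- exact: strand_coordZ.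
- exact: strand_coordP.
- exact: strand_basis_in.
exact: strand_coord_deg.
Qed.

End Strand.

(** * Regularity of symbolic powers *)

(** Here [shift_le] takes [F] itself as the complex of projectives, with the standard basis and its
    coordinates. A bound found on one resolution thus holds on the one realizing [reg]. *)
Lemma resolution_shift_le (K : fieldType) n (L : {mpoly K[n]} -> Prop) F F' b :
  is_ideal L -> standard_resolution L F -> standard_resolution L F' ->
  (forall i (j : 'I_(rank F i)), (shift F i j <= i + b)%N) ->
  forall i (l : 'I_(rank F' i)), (shift F' i l <= i + b)%N.
Proof.
move=> idL hF hF' hb i l; pose S := {mpoly K[n]}.
have gS := standard_graded_module K n.
pose homC j d := @homog_row K n nat (fun=> 1%N) _ (shift F j) d.
pose augF := @augmentation K n nat S id F.
have addIn' : forall a b c : nat, a + c = b + c -> a = b by move=> x y z; apply: addIn.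
have lift j d (v : 'rV[S]_(rank F j)) u : homC j d v -> v = u *m diff F j ->
    exists u', homC j.+1 d u' /\ v = u' *m diff F j.
  by apply: homog_row_lift => x y a; apply: (diff_homogeneous hF).
have augP d v : homC 0%N d v -> pihomog mdeg d (augF v) = augF v.
  move=> hv; have := pr_lincomb gS d v (aug_homogeneous hF).
  by rewrite (homog_part_id hv).
apply: (@shift_le K n L F' hF' _ idfun (rank F) (diff F) (fun _ _ => True) homC augF
  _ _ _ _ _ _ _ _ _ _ _ _ _ (fun j => 'I_(rank F j)) (fun j l => delta_mx 0 l)
  (fun j v l => v 0 l)) => //.
- by move=> *; apply: homog_row0.
- by move=> *; apply: homog_rowD.
- move=> j c d p v /dhomog_mf hp; apply: homog_row_scale => a /hp <-.
  by rewrite weighted_degree1.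
- exact: exact_mulmx0 (exact_at_S hF).
- by move=> j d v hv /(exact_at_S hF)[u /(lift _ _ _ _ hv)].
- exact: (lincombD gS (aug F)).
- exact: (lincombZ gS (aug F)).
- move=> f d /(aug_image hF)[v vE] fd.
  exists (homog_part (fun=> 1%N) (shift F 0) d v); split; first exact: homog_partP.
  rewrite -[augF _](pr_lincomb gS d v (aug_homogeneous hF)).
  by rewrite -[lincomb _ _ v]/(augmentation id v) -vE pihomog_dE.
- by move=> v _; apply/(aug_image hF); exists v.
- by move=> v _; apply/(exact_at_0 hF); exists v.
- by move=> d v hv /(exact_at_0 hF)[u /(lift _ _ _ _ hv)].
- by move=> j u v x; rewrite mxE.
- by move=> j p v x; rewrite mxE.
- by move=> j v _; apply: row_sum_delta.
move=> j d v x a hv /hv <-; rewrite weighted_degree1.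
by rewrite leq_add2l.
Qed.

Lemma subz_le (s i b : nat) : (s <= i + b)%N -> s%:Z - i%:Z <= b%:Z.
Proof. by lia. Qed.

Theorem theorem1p2 (K : fieldType) (n : nat) (I : {mpoly K[n]} -> Prop)
  (hI : minimal_intersection_type I) :
  [/\ (* (a) *)
      forall u, minimal_monomial_generator I u -> forall k, (0 < k)%N ->
        minimal_monomial_generator (symbolic_power I k) (u *+ k)%MM,
      (* (b) *)
      forall k, (0 < k)%N ->
        (omega (symbolic_power I k))%:Z <= reg (symbolic_power I k) /\
        (omega I * k <= omega (symbolic_power I k))%N,
      (* (c) *)
      linear_powers I -> forall k, (0 < k)%N ->
        reg (ideal_pow I k) <= reg (symbolic_power I k)
    & (* (d) *)
      linear_powers I ->
      forall (r : nat) (u : 'I_r -> 'X_{1..n}) (q : 'I_r -> nat),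
        minimal_rees_generators I u q ->
        reg_x_rees I u q = 0 ->
        (forall k, (0 < k)%N -> rees_d u q k = (omega I * k)%N) ->
        forall k, (0 < k)%N ->
          reg (symbolic_power I k) = reg (ideal_pow I k)].
Proof.
have [m [V [e [m0 pos inc IE]]]] := hI.
have IP f : I f <-> forall i, order_ge (V i) (e i) f.
  by rewrite IE; split=> h i; apply/monomial_prime_pow_order; apply: h.
have incV i j : i != j -> exists2 v, v \in V i & v \notin V j.
  move=> /inc nsub; apply: NNPP => hn; apply: nsub => f.
  apply: ideal_gen_sub; first exact: ideal_gen_ideal.
  move=> _ [v vi ->]; apply: ideal_gen_in; exists v => //.
  by apply/negPn/negP => vj; apply: hn; exists v.
have monS := symbolic_power_monomial pos incV IP.
have monI := intersection_monomial pos incV IP.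
have sub := ideal_pow_symbolic pos incV IP.
have up := minimal_exponent_symbolic pos incV IP.
have [[w hw wI] _] := omegaP monI (intersection_neq0 pos IP).
have hwk k : (0 < k)%N -> minimal_exponent (symbolic_power I k) (w *+ k)%MM.
  by move=> k0; apply: up.
have wk k : mdeg (w *+ k)%MM = (omega I * k)%N by rewrite mdegMn wI.
have powX k : ideal_pow I k ('X_[w *+ k]).
  by rewrite -mpolyXn; apply: ideal_pow_expr; case: hw.
have regS k : (0 < k)%N -> is_reg (symbolic_power I k) (reg (symbolic_power I k)).
  by move=> /hwk[Lw _]; apply: regP => //; exists (w *+ k)%MM.
have partb k : (0 < k)%N -> (omega (symbolic_power I k))%:Z <= reg (symbolic_power I k) /\
    (omega I * k <= omega (symbolic_power I k))%N.
  move=> k0; have [|[u hu <-] le] := omegaP (monS k).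
    by exists (w *+ k)%MM; case: (hwk k k0).
  split; last by rewrite -wk; apply/le/hwk.
  by apply: (is_reg_ge (regS k k0) _ (monS k) hu) => //; case: hu.
have regpow : linear_powers I -> forall k, (0 < k)%N ->
    reg (ideal_pow I k) = (omega I * k)%N%:Z.
  move=> lin k k0; have [F [d [hF Fd]]] := lin k k0.
  (* The power $w^k$ lies in $I^k$ and is minimal even in $I^{(k)}$, so its degree $\omega(I)k$ is
     the generating degree [d] of the linear resolution. *)
  have [l ld] := resolution_minimal_exponent hF (sub k) (monS k) (hwk k k0) (powX k).
  have dE : d = (omega I * k)%N by rewrite -wk -ld Fd addn0.
  have : is_reg (ideal_pow I k) (reg (ideal_pow I k)).
    (* The linear resolution itself witnesses that a regularity exists. *)
    apply: epsilon_spec; exists d%:Z, F; split=> //.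
      by exists 0%N, l; rewrite Fd addn0 subr0.
    by move=> i j; rewrite Fd PoszD addrK.
  move=> hreg; apply/eqP; rewrite eq_le -{2}wk.
  rewrite (is_reg_ge hreg (sub k) (monS k) (hwk k k0) (powX k)) andbT.
  have [F' [hF' [i [j <-]] _]] := hreg.
  have := resolution_shift_le (ideal_gen_ideal _) hF hF' (b := d) _ j.
  rewrite -dE => /(_ (fun i' j' => eq_leq (etrans (Fd i' j') (addnC _ _)))); exact: subz_le.
split=> [u hu k k0|//|lin k k0|lin r u q [q0 gen _] reg0 dk k k0].
- by apply/(minimal_monomial_generatorP _ (monS k))/up => //; apply/minimal_monomial_generatorP.
- have [h1 h2] := partb k k0; rewrite regpow //; apply: le_trans h1; by rewrite lez_nat.
have [h1 h2] := partb k k0; rewrite regpow //; apply/eqP; rewrite eq_le.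
apply/andP; split; last by apply: le_trans h1; rewrite lez_nat.
have idS j : is_ideal (symbolic_power I j) by case: (monS j).
have [F [hF _ Flin]] := reg_x_reesP q0 gen.
have [F' [hF' [i [j <-]] _]] := regS k k0.
(* As $\mathrm{reg}_x=0$, the $x$-shifts of [F] in homological degree $i$ are at most $i$, so those
   of [F'] are at most $i+d(I,k)=i+\omega(I)k$. *)
have := @strand_shift_le _ _ _ _ _ _ idS q0 F hF k _ F' i j hF'.
rewrite dk // => le; apply: subz_le.
by apply: le => i' j'; have := Flin i' j'; rewrite reg0 subr_le0 lez_nat.
Qed.
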